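(* Let $0<\omega\leq 1$ and let $\mathfrak{C}_\omega$ denote the $G_\omega$-concurrence of bipartite states. Then for every bipartite quantum state $\rho_{AB}$: (i) (Faithfulness) $\mathfrak{C}_\omega(\rho_{AB})\geq 0$, and $\mathfrak{C}_\omega(\rho_{AB})=0$ if and only if $\rho_{AB}$ is separable. (ii) (Monotonicity) $\mathfrak{C}_\omega[\Lambda_{\rm LOCC}(\rho_{AB})]\leq \mathfrak{C}_\omega(\rho_{AB})$ for every LOCC operation $\Lambda_{\rm LOCC}$. (iii) (Local unitary invariance) $\mathfrak{C}_\omega(\rho_{AB})=\mathfrak{C}_\omega\big((U_A\otimes U_B)\rho_{AB}(U_A^\dagger\otimes U_B^\dagger)\big)$ for all unitaries $U_A$ on $A$ and $U_B$ on $B$. (iv) (Strong monotonicity) $\mathfrak{C}_\omega(\rho_{AB})\geq\sum_i p_i\,\mathfrak{C}_\omega(\sigma_i)$ for every ensemble $\{p_i,\sigma_i\}$ obtained by an LOCC operation acting on $\rho_{AB}$, where outcome state $\sigma_i$ occurs with probability $p_i$. (v) (Convexity) $\mathfrak{C}_\omega(\rho_{AB})\leq\sum_i p_i\,\mathfrak{C}_\omega(\rho_{AB}^i)$ whenever $\rho_{AB}=\sum_i p_i\rho_{AB}^i$ with states $\rho^i_{AB}$, $p_i>0$ and $\sum_i p_i=1$.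
   Context: Systems $A$ and $B$ have finite-dimensional Hilbert spaces. For $0<\omega\leq1$ the $G_\omega$-concurrence of a bipartite pure state $|\varphi\rangle_{AB}$ is $\mathfrak{C}_\omega(|\varphi\rangle_{AB})=[\mathrm{tr}(\rho_A^\omega)-1]^\omega$, where $\rho_A=\mathrm{tr}_B(|\varphi\rangle_{AB}\langle\varphi|)$ is the reduced density operator; equivalently, if $|\varphi\rangle_{AB}=\sum_i\sqrt{\chi_i}|i_A\rangle|i_B\rangle$ is a Schmidt decomposition ($\chi_i\ge 0$, $\sum_i\chi_i=1$), then $\mathfrak{C}_\omega(|\varphi\rangle_{AB})=(\sum_i\chi_i^\omega-1)^\omega$, where $0^\omega=0$. For a mixed state, $\mathfrak{C}_\omega(\rho_{AB})=\min\sum_i p_i\,\mathfrak{C}_\omega(|\varphi_i\rangle)$, the minimum being over all pure state decompositions $\rho_{AB}=\sum_i p_i|\varphi_i\rangle\langle\varphi_i|$ (with $p_i\ge0$, $\sum_i p_i=1$). A state is separable if it is a convex combination of product pure states. LOCC means local operations and classical communication: finite sequences of local quantum operations (possibly with recorded measurement outcomes) performed on $A$ or on $B$, each of which may depend on previously communicated outcomes. In (ii), $\Lambda_{\rm LOCC}(\rho_{AB})$ is the output state averaged over outcomes; in (iv), the ensemble is indexed by the recorded outcomes.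
   Formalization: In (i), ''concurrence zero implies separable'' is stated only for ω < 1, because at ω = 1 the concurrence tr(ρ_A) − 1 vanishes on every state, including the entangled Bell state; all else is proved for 0 < ω ≤ 1. *)

(* Defs.v *)
From mathcomp Require Import all_boot all_order all_algebra.
From mathcomp Require Import all_classical all_reals all_analysis.
From mathcomp Require Import complex mxtens.

Set Implicit Arguments.
Unset Strict Implicit.
Unset Printing Implicit Defensive.

Import Order.TTheory GRing.Theory Num.Theory.

Local Open Scope classical_set_scope.
Local Open Scope ring_scope.
Local Open Scope complex_scope.
Local Open Scope sesquilinear_scope.

(* The systems A and B are C^m and C^n with C = R[i].  The basis vector
   |i>|j> of C^m (x) C^n is the one of index mxtens_index (i, j) in
   'I_(m * n), so that the tensor product of operators (and of column vectors,
   up to 1 * 1 = 1) is the Kronecker product *t. *)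

(* The order of R[i] makes [0 <= z] entail that z is real; over the complex
   field the second clause alone therefore already implies hermiticity. *)
Definition density (R : realType) (d : nat) (rho : 'M[R[i]]_d) : Prop :=
  [/\ rho^t* = rho,
      forall v : 'cV[R[i]]_d, 0 <= (v^t* *m rho *m v) 0 0
    & \tr rho = 1].

Definition unit_vector (R : realType) (d : nat) (v : 'cV[R[i]]_d) : Prop :=
  v^t* *m v = 1%:M.

Definition projector (R : realType) (d : nat) (v : 'cV[R[i]]_d) :
  'M[R[i]]_d := v *m v^t*.

Definition ptraceB (R : realType) (m n : nat) (X : 'M[R[i]]_(m * n)) :
  'M[R[i]]_m :=
  \matrix_(i, j) \sum_k X (mxtens_index (i, k)) (mxtens_index (j, k)).

(* A^w for positive semidefinite A, by functional calculus on the spectral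
   decomposition A = P^-1 diag(l) P with P unitary.  For w != 0 one has
   0 `^ w = 0, so the kernel of A does not contribute. *)
Definition mxpowR (R : realType) (d : nat) (A : 'M[R[i]]_d) (w : R) :
  'M[R[i]]_d :=
  invmx (spectralmx A)
  *m diag_mx (map_mx (fun l : R[i] => (complex.Re l `^ w)%:C) (spectral_diag A))
  *m spectralmx A.

Definition Gconcurrence_pure (R : realType) (m n : nat) (w : R)
    (phi : 'cV[R[i]]_(m * n)) : R :=
  (complex.Re (\tr (mxpowR (ptraceB (projector phi)) w)) - 1) `^ w.

Definition prob_vector (R : realType) (K : nat) (p : 'I_K -> R) : Prop :=
  (forall k, 0 <= p k) /\ \sum_k p k = 1.

Definition pure_decomposition (R : realType) (d : nat) (rho : 'M[R[i]]_d)
    (K : nat) (p : 'I_K -> R) (phi : 'I_K -> 'cV[R[i]]_d) : Prop :=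
  [/\ prob_vector p,
      forall k, unit_vector (phi k)
    & rho = \sum_k (p k)%:C *: projector (phi k)].

(* Convex roof.  The set is nonempty and bounded below when rho is a density
   matrix, and the infimum is then a minimum (by compactness). *)
Definition Gconcurrence (R : realType) (m n : nat) (w : R)
    (rho : 'M[R[i]]_(m * n)) : R :=
  inf [set x : R | exists (K : nat) (p : 'I_K -> R)
                          (phi : 'I_K -> 'cV[R[i]]_(m * n)),
         pure_decomposition rho p phi /\
         x = \sum_k p k * Gconcurrence_pure w (phi k)].

(* projector a *t projector b is the projector on the product vector a (x) b *)
Definition separable (R : realType) (m n : nat) (rho : 'M[R[i]]_(m * n)) :
  Prop :=
  exists (K : nat) (p : 'I_K -> R) (a : 'I_K -> 'cV[R[i]]_m)
         (b : 'I_K -> 'cV[R[i]]_n),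
    [/\ prob_vector p,
        forall k, unit_vector (a k),
        forall k, unit_vector (b k)
      & rho = \sum_k (p k)%:C *: (projector (a k) *t projector (b k))].

(* A local operation on C^d with K communicated outcomes: outcome k is the
   completely positive map X |-> \sum_(M <- E k) M X M^dagger from C^d to
   C^(d' k), and the sum over k of these maps is trace preserving.  The list
   E k may have several elements, so a local operation may also lose
   information (partial trace, noise). *)
Definition local_instrument (R : realType) (d K : nat) (d' : 'I_K -> nat)
    (E : forall k, seq 'M[R[i]]_(d' k, d)) : Prop :=
  \sum_k \sum_(M <- E k) M^t* *m M = 1%:M.

Definition kraus (R : realType) (d d' : nat) (E : seq 'M[R[i]]_(d', d))
    (X : 'M[R[i]]_d) : 'M[R[i]]_d' := \sum_(M <- E) M *m X *m M^t*.

(* LOCC protocols from C^m (x) C^n to C^dA (x) C^dB with recorded outcomes in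
   I: a finite tree whose nodes are local operations by A or by B, the
   continuation depending on the outcome just communicated.  Local dimensions
   may change along the way (ancillas, discarded subsystems).  A branch ends
   with a label in I; several branches may carry the same label, when not all
   of the communicated outcomes are kept in the final record. *)
Inductive locc (R : realType) (I : finType) (dA dB : nat) :
  nat -> nat -> Type :=
| LoccDone of I : locc R I dA dB dA dB
| LoccA (m n K : nat) (m' : 'I_K -> nat)
    (E : forall k, seq 'M[R[i]]_(m' k, m)) of local_instrument E
    & (forall k, locc R I dA dB (m' k) n) : locc R I dA dB m n
| LoccB (m n K : nat) (n' : 'I_K -> nat)
    (E : forall k, seq 'M[R[i]]_(n' k, n)) of local_instrument E
    & (forall k, locc R I dA dB m (n' k)) : locc R I dA dB m n.

(* The unnormalised output state for the recorded outcome i; its trace is the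
   probability of i. *)
Fixpoint locc_branch (R : realType) (I : finType) (dA dB m n : nat)
    (P : locc R I dA dB m n) (i : I) {struct P} :
    'M[R[i]]_(m * n) -> 'M[R[i]]_(dA * dB) :=
  match P in locc _ _ _ _ m n
    return 'M[R[i]]_(m * n) -> 'M[R[i]]_(dA * dB) with
  | LoccDone j => fun X => if j == i then X else 0
  | LoccA m n K m' E _ next => fun X =>
      \sum_k locc_branch (next k) i
               (kraus [seq M *t (1%:M : 'M[R[i]]_n) | M <- E k] X)
  | LoccB m n K n' E _ next => fun X =>
      \sum_k locc_branch (next k) i
               (kraus [seq (1%:M : 'M[R[i]]_m) *t M | M <- E k] X)
  end.

Definition locc_average (R : realType) (I : finType) (dA dB m n : nat)
    (P : locc R I dA dB m n) (X : 'M[R[i]]_(m * n)) : 'M[R[i]]_(dA * dB) :=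
  \sum_i locc_branch P i X.

Definition locc_ensemble (R : realType) (I : finType) (dA dB m n : nat)
    (P : locc R I dA dB m n) (rho : 'M[R[i]]_(m * n))
    (p : I -> R) (sigma : I -> 'M[R[i]]_(dA * dB)) : Prop :=
  forall i, [/\ 0 <= p i, density (sigma i)
              & locc_branch P i rho = (p i)%:C *: sigma i].

(* Main.v *)
(* For a pure state with coefficient matrix Y, both reductions have the spectrum
   of Y Y^*, and f(Y) := tr (Y Y^* )^w is the minimum of sum_i <e_i, Y Y^* e_i>^w
   over orthonormal bases e; this makes f concave in either reduced state.  A
   local operation on one side splits the reduced state of the other side into
   a convex mixture, so, t |-> (t - 1)^w being concave and increasing on t >= 1,
   it does not increase the average concurrence of a pure state.  Applying this
   to every term of a decomposition, along the protocol tree, gives (iv), hence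
   (ii) and (iii).

   For faithfulness, t^w - t >= (1 - w) t (1 - t) bounds the concurrence of a
   pure state below by (1 - w) (1 - tr rho_A^2).  If the infimum is 0,
   Caratheodory's theorem yields decompositions with a fixed number of terms and
   cost tending to 0; in a limit along an ultrafilter every term of nonzero
   weight has a reduced state of purity 1, so it is a product state. *)

Require Import Defs.
From mathcomp Require Import all_boot all_order all_algebra.
From mathcomp Require Import all_classical all_reals all_analysis.
From mathcomp Require Import complex mxtens.
From mathcomp Require Import zify ring lra.

Set Implicit Arguments.
Unset Strict Implicit.
Unset Printing Implicit Defensive.

Import Order.TTheory GRing.Theory Num.Theory.

Local Open Scope ring_scope.
Local Open Scope complex_scope.
Local Open Scope sesquilinear_scope.

(** * The trace of a power of a positive matrix *)

Section PowR.
Variables (R : realType) (w : R).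
Hypotheses (w_gt0 : 0 < w) (w_le1 : w <= 1).

Lemma powR_le_tangent (t : R) : 0 <= t -> t `^ w <= 1 + w * (t - 1).
Proof.
move=> t0; have [w1|w1] := eqVneq w 1; first by rewrite w1 powRr1//; lra.
have wlt1 : w < 1 by rewrite lt_neqAle w1.
have := @conjugate_powR R (t `^ w) 1 w^-1 (1 - w)^-1.
rewrite powR_ge0 ler01 !invr_gt0 subr_gt0 !invrK => /(_ isT isT w_gt0 wlt1).
rewrite addrCA subrr addr0 => /(_ erefl).
by rewrite -powRrM mulfV ?gt_eqF// powRr1// powR1; lra.
Qed.

(** Sum the tangent bound at the average a. The tangent has intercept (1 - w) a^w >= 0, so weights
    of total mass below 1 are allowed; [bessel] supplies only such weights. *)
Lemma powR_jensen (I : finType) (q x : I -> R) :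
  (forall i, 0 <= q i) -> \sum_i q i <= 1 -> (forall i, 0 <= x i) ->
  \sum_i q i * x i `^ w <= (\sum_i q i * x i) `^ w.
Proof.
move=> q0 q1 x0; set a := \sum_i q i * x i.
have a_ge0 : 0 <= a by apply: sumr_ge0 => i _; rewrite mulr_ge0.
have [a0|an0] := eqVneq a 0.
  rewrite a0 powR0 ?gt_eqF// big1// => i _.
  have /eqP : q i * x i = 0.
    by apply: (psumr_eq0P _ a0) => // j _; rewrite mulr_ge0.
  by rewrite mulf_eq0 => /orP[] /eqP ->; rewrite ?mul0r// powR0 ?gt_eqF// mulr0.
have a_gt0 : 0 < a by rewrite lt_neqAle eq_sym an0.
have step i : q i * x i `^ w <=
    a `^ w * (q i * (1 - w)) + a `^ w * (w / a) * (q i * x i).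
  rewrite (_ : _ + _ = q i * (a `^ w * (1 + w * (x i / a - 1)))).
    rewrite ler_wpM2l// -{1}(divfK an0 (x i)) powRM ?divr_ge0// mulrC.
    by rewrite ler_wpM2l ?powR_ge0// powR_le_tangent// divr_ge0.
  by field.
apply: le_trans (ler_sum _ (fun i _ => step i)) _.
rewrite big_split/= -!mulr_sumr -mulr_suml -/a.
rewrite -mulrA divfK// -mulrDr ger_pMr ?powR_gt0//.
have : (\sum_i q i) * (1 - w) <= 1 * (1 - w) by rewrite ler_wpM2r// subr_ge0.
lra.
Qed.

End PowR.

(** * Spectra of Gram matrices and traces of their powers *)

Section SpectralPower.
Variable R : realType.
Local Notation C := R[i].

Definition sqmod (z : C) : R := complex.Re z ^+ 2 + complex.Im z ^+ 2.

Lemma sqmod_ge0 z : 0 <= sqmod z.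
Proof. by rewrite addr_ge0// sqr_ge0. Qed.

Lemma mulCJ (z : C) : z * Num.conj z = (sqmod z)%:C.
Proof.
case: z => a b; change (Num.conj (a +i* b)) with (a -i* b); rewrite /sqmod/=.
by apply/eqP; rewrite eq_complex/=; apply/andP; split; apply/eqP; ring.
Qed.

Lemma sqmodJ (z : C) : sqmod (Num.conj z) = sqmod z.
Proof. by case: z => a b; rewrite /sqmod/= sqrrN. Qed.

Definition rowsq (m n : nat) (X : 'M[C]_(m, n)) (i : 'I_m) : R :=
  \sum_j sqmod (X i j).

Definition colsq (m n : nat) (X : 'M[C]_(m, n)) (j : 'I_n) : R :=
  \sum_i sqmod (X i j).

Lemma rowsq_ge0 m n (X : 'M[C]_(m, n)) i : 0 <= rowsq X i.
Proof. by apply: sumr_ge0 => j _; exact: sqmod_ge0. Qed.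

Lemma rowsqE m n (X : 'M[C]_(m, n)) i : (X *m X^t*) i i = (rowsq X i)%:C.
Proof.
by rewrite mxE rmorph_sum; apply: eq_bigr => k _; rewrite !mxE mulCJ.
Qed.

Lemma colsq_adj m n (X : 'M[C]_(m, n)) i : colsq (X^t*) i = rowsq X i.
Proof. by apply: eq_bigr => k _; rewrite !mxE sqmodJ. Qed.

Lemma adjmxM m n p (X : 'M[C]_(m, n)) (Y : 'M[C]_(n, p)) :
  (X *m Y)^t* = Y^t* *m X^t*.
Proof. by rewrite trmx_mul map_mxM. Qed.

Lemma colsqE m n (X : 'M[C]_(m, n)) i : (X^t* *m X) i i = (colsq X i)%:C.
Proof. by rewrite -[X in _ *m X]trmxCK rowsqE -colsq_adj trmxCK. Qed.

Lemma unitary_adjmul n (U : 'M[C]_n) : U \is unitarymx -> U^t* *m U = 1%:M.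
Proof. by move=> Uu; rewrite -invmx_unitary// mulVmx// unitarymx_unit. Qed.

Lemma gram_normal m n (Y : 'M[C]_(m, n)) : Y *m Y^t* \is normalmx.
Proof. by apply/normalmxP; rewrite adjmxM trmxCK. Qed.

Lemma normal_spectralE n (A : 'M[C]_n) : A \is normalmx ->
  spectralmx A *m A *m (spectralmx A)^t* = diag_mx (spectral_diag A).
Proof.
move=> /orthomx_spectralP AE; have Pu := spectral_unitarymx A.
rewrite {2}AE invmx_unitary// !mulmxA (unitarymxP Pu) mul1mx.
by rewrite -mulmxA (unitarymxP Pu) mulmx1.
Qed.

(** Conjugating Y Y^* by the diagonalising unitary P gives the Gram matrix of P Y. The eigenvalues
    are thus real, nonnegative and computable as squared row norms. *)
Lemma spectral_diag_gram m n (Y : 'M[C]_(m, n)) k :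
  spectral_diag (Y *m Y^t*) 0 k = (rowsq (spectralmx (Y *m Y^t*) *m Y) k)%:C.
Proof.
have /matrixP/(_ k k) := normal_spectralE (gram_normal Y).
by rewrite [in X in _ = X -> _]mxE eqxx mulr1n => <-; rewrite -rowsqE adjmxM !mulmxA.
Qed.

Definition trpow (w : R) (n : nat) (A : 'M[C]_n) : R :=
  \sum_k complex.Re (spectral_diag A 0 k) `^ w.

Lemma trpowE w n (A : 'M[C]_n) : complex.Re (\tr (mxpowR A w)) = trpow w A.
Proof.
rewrite /mxpowR mxtrace_mulC mulmxA mulmxV ?spectral_unit// mul1mx mxtrace_diag.
rewrite /trpow (eq_bigr (fun k => (complex.Re (spectral_diag A 0 k) `^ w)%:C)).
  by rewrite -rmorph_sum.
by move=> k _; rewrite mxE.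
Qed.

Lemma trpow_rowsq w m n (Y : 'M[C]_(m, n)) :
  trpow w (Y *m Y^t*) = \sum_k rowsq (spectralmx (Y *m Y^t*) *m Y) k `^ w.
Proof. by apply: eq_bigr => k _; rewrite spectral_diag_gram. Qed.

Lemma colsq_isom p m n (U : 'M[C]_(p, m)) (Y : 'M[C]_(m, n)) j :
  U^t* *m U = 1%:M -> colsq (U *m Y) j = colsq Y j.
Proof.
move=> Uu; apply: complexI; rewrite -!colsqE adjmxM -mulmxA (mulmxA (U^t*)) Uu.
by rewrite mul1mx.
Qed.

(* If the rows of [Z] are orthogonal, then [Z^t* L^-1 Z] is a projection, and
   a diagonal entry of a projection is at most 1. *)
Lemma bessel m n (Z : 'M[C]_(m, n)) (l : 'rV[R]_m) j :
  Z *m Z^t* = diag_mx (map_mx (real_complex R) l) ->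
  \sum_k sqmod (Z k j) / l 0 k <= 1.
Proof.
(* Since 0^-1 = 0, [D] is the pseudoinverse of diag l, and [Q] is a projection even when some rows
   of [Z] vanish. *)
move=> ZZ; pose D := diag_mx (map_mx (fun x : R => (x^-1)%:C) l).
pose Q := Z^t* *m D *m Z.
have QQ : Q *m Q = Q.
  have DD : D *m (Z *m Z^t*) *m D = D.
    rewrite ZZ /D !mulmx_diag; congr diag_mx; apply/rowP => k.
    rewrite !mxE -!rmorphM/=.
    have [->|l0] := eqVneq (l 0 k) 0; first by rewrite invr0 !mul0r.
    by rewrite mulVf// mul1r.
  by rewrite /Q -[X in _ = _ *m X *m _]DD !mulmxA.
have DJ : D^t* = D.
  apply/matrixP => a b; rewrite !mxE eq_sym; case: eqVneq => [->|_].
    by rewrite !mulr1n; exact: conjc_real.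
  by rewrite !mulr0n conjC0.
have QJ : Q^t* = Q by rewrite /Q !adjmxM trmxCK DJ mulmxA.
have Qjj : Q j j = (\sum_k sqmod (Z k j) / l 0 k)%:C.
  rewrite /Q mxE rmorph_sum; apply: eq_bigr => k _.
  rewrite mul_mx_diag !mxE mulrAC [_ * Z k j]mulrC mulCJ.
  by rewrite -rmorphM.
have : (Q^t* *m Q) j j = Q j j by rewrite QJ QQ.
rewrite colsqE Qjj => /complexI cE.
set s := \sum_k _ / _ in Qjj cE *.
(* As Q^* Q = Q, the diagonal entry s is also the squared norm of column j of [Q], and s is one of
   the entries of that column. *)
have : s ^+ 2 <= s.
  rewrite -{2}cE /colsq (bigD1 j)//= Qjj.
  rewrite (_ : sqmod s%:C = s ^+ 2); last by rewrite /sqmod/= expr0n/= addr0.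
  rewrite lerDl sumr_ge0// => k _; exact: sqmod_ge0.
have [/ltW -> //|s1 ss] := ltP s 1; nra.
Qed.

Section Exponent.
Variable w : R.
Hypotheses (w_gt0 : 0 < w) (w_le1 : w <= 1).

(* The weights of a decomposition into rank one terms are majorized by the
   spectrum, and t |-> t^w is concave. *)
Lemma trpow_le_colsq m n (Y : 'M[C]_(m, n)) :
  trpow w (Y *m Y^t*) <= \sum_j colsq Y j `^ w.
Proof.
set P := spectralmx (Y *m Y^t*); pose Z := P *m Y.
have Pu : P \is unitarymx := spectral_unitarymx _.
pose l := \row_k rowsq Z k.
have ZZ : Z *m Z^t* = diag_mx (map_mx (real_complex R) l).
  rewrite /Z adjmxM !mulmxA -(mulmxA P Y) normal_spectralE ?gram_normal//.
  by congr diag_mx; apply/rowP => k; rewrite spectral_diag_gram !mxE.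
have l0 k : rowsq Z k = 0 -> forall j, sqmod (Z k j) = 0.
  by move=> Zk0 j; apply: (psumr_eq0P _ Zk0) => // i _; exact: sqmod_ge0.
(* For fixed k with a nonzero eigenvalue the weights sum to 1 over j; for fixed j they sum to at
   most 1 over k. Zero eigenvalues contribute nothing because 0^w = 0. *)
have -> : trpow w (Y *m Y^t*) =
    \sum_k \sum_j (sqmod (Z k j) / l 0 k) * l 0 k `^ w.
  rewrite trpow_rowsq; apply: eq_bigr => k _; rewrite -!mulr_suml !mxE.
  rewrite -/P -/Z -/(rowsq Z k).
  have [->|Zk] := eqVneq (rowsq Z k) 0; first by rewrite powR0 ?gt_eqF// mulr0.
  by rewrite mulfV// mul1r.
rewrite exchange_big/=; apply: ler_sum => j _.
apply: le_trans (powR_jensen w_gt0 w_le1 _ _ _) _ => //=.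
- by move=> k; rewrite divr_ge0 ?sqmod_ge0// mxE rowsq_ge0.
- exact: bessel.
- by move=> k; rewrite mxE rowsq_ge0.
(* The average inside the power is the squared norm of column j of [Z], which P leaves equal to that
   of [Y]. *)
rewrite -(colsq_isom _ _ (unitary_adjmul Pu)) -/Z /colsq.
rewrite (eq_bigr (fun k => sqmod (Z k j)))// => k _.
rewrite (_ : l 0 k = rowsq Z k); last by rewrite mxE.
have [Zk|Zk] := eqVneq (rowsq Z k) 0; first by rewrite Zk mulr0 l0.
by rewrite divfK.
Qed.

(** The columns of the adjoint of P Y have the eigenvalues of Y Y^* as squared norms, and their Gram
    matrix is Y^* Y. So [trpow_le_colsq] compares the two traces without matching the spectra;
    symmetry then gives equality. *)
Lemma trpow_adj_le m n (Y : 'M[C]_(m, n)) :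
  trpow w (Y^t* *m Y) <= trpow w (Y *m Y^t*).
Proof.
set P := spectralmx (Y *m Y^t*).
have Pu := unitary_adjmul (spectral_unitarymx (Y *m Y^t*)).
have -> : Y^t* *m Y = (P *m Y)^t* *m (P *m Y)^t*^t*.
  by rewrite trmxCK adjmxM -mulmxA (mulmxA (P^t*)) Pu mul1mx.
apply: le_trans (trpow_le_colsq _) _.
by rewrite trpow_rowsq ler_sum// => k _; rewrite colsq_adj.
Qed.

Lemma trpow_adj m n (Y : 'M[C]_(m, n)) :
  trpow w (Y^t* *m Y) = trpow w (Y *m Y^t*).
Proof.
apply/eqP; rewrite eq_le trpow_adj_le/=.
by have := trpow_adj_le (Y^t*); rewrite trmxCK.
Qed.

(** The diagonal of Y Y^* in any orthonormal basis has at least the sum of w-th powers of the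
    spectrum. [U] is left free so that one basis can serve several matrices at once. *)
Lemma trpow_le_rowsq m n (U : 'M[C]_m) (Y : 'M[C]_(m, n)) :
  U \is unitarymx -> trpow w (Y *m Y^t*) <= \sum_i rowsq (U *m Y) i `^ w.
Proof.
move=> Uu; rewrite -trpow_adj.
have -> : Y^t* *m Y = (U *m Y)^t* *m (U *m Y)^t*^t*.
  by rewrite trmxCK adjmxM -mulmxA (mulmxA (U^t*)) unitary_adjmul// mul1mx.
apply: le_trans (trpow_le_colsq _) _.
by apply: ler_sum => k _; rewrite colsq_adj.
Qed.

End Exponent.
End SpectralPower.

(** * Pure states under a local operation *)

Section PureState.
Variable R : realType.
Local Notation C := R[i].

(** The squared Frobenius norm; for a coefficient matrix, the squared norm of the state. *)
Definition sqnorm (m n : nat) (X : 'M[C]_(m, n)) : R := \sum_i rowsq X i.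

Lemma sqnorm_ge0 m n (X : 'M[C]_(m, n)) : 0 <= sqnorm X.
Proof. by apply: sumr_ge0 => i _; exact: rowsq_ge0. Qed.

Lemma sqnorm_adj m n (X : 'M[C]_(m, n)) : sqnorm (X^t*) = sqnorm X.
Proof.
rewrite /sqnorm /rowsq exchange_big/=.
by apply: eq_bigr => i _; apply: eq_bigr => j _; rewrite !mxE sqmodJ.
Qed.

Lemma sqnormE m n (X : 'M[C]_(m, n)) : \tr (X *m X^t*) = (sqnorm X)%:C.
Proof. by rewrite rmorph_sum; apply: eq_bigr => i _; rewrite rowsqE. Qed.

Lemma sqnorm_isom p m n (U : 'M[C]_(p, m)) (Y : 'M[C]_(m, n)) :
  U^t* *m U = 1%:M -> sqnorm (U *m Y) = sqnorm Y.
Proof.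
move=> Uu; apply: complexI; rewrite -!sqnormE mxtrace_mulC adjmxM -mulmxA.
by rewrite (mulmxA (U^t*)) Uu mul1mx mxtrace_mulC.
Qed.

Lemma sqmodZ (c : R) z : sqmod (c%:C * z) = c ^+ 2 * sqmod z.
Proof. by case: z => a b; rewrite /sqmod/= !mul0r subr0 addr0 !exprMn mulrDr. Qed.

Lemma rowsqZ (c : R) m n (X : 'M[C]_(m, n)) i :
  rowsq (c%:C *: X) i = c ^+ 2 * rowsq X i.
Proof. by rewrite mulr_sumr; apply: eq_bigr => j _; rewrite mxE sqmodZ. Qed.

Lemma sqnormZ (c : R) m n (X : 'M[C]_(m, n)) :
  sqnorm (c%:C *: X) = c ^+ 2 * sqnorm X.
Proof. by rewrite mulr_sumr; apply: eq_bigr => i _; rewrite rowsqZ. Qed.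

Lemma sqmod_eq0 (z : C) : sqmod z = 0 -> z = 0.
Proof.
move=> /eqP; case: z => a b; rewrite /sqmod/= paddr_eq0 ?sqr_ge0// !sqrf_eq0.
by case/andP => /eqP -> /eqP ->.
Qed.

Lemma sqnorm_eq0 m n (X : 'M[C]_(m, n)) : sqnorm X = 0 -> X = 0.
Proof.
move=> X0; apply/matrixP => i j; rewrite mxE; apply: sqmod_eq0.
have Xi : rowsq X i = 0.
  by apply: (psumr_eq0P _ X0) => // k _; exact: rowsq_ge0.
by apply: (psumr_eq0P _ Xi) => // k _; exact: sqmod_ge0.
Qed.

Lemma unit_vectorP d (v : 'cV[C]_d) : unit_vector v <-> sqnorm v = 1.
Proof.
rewrite /unit_vector; split => [vv|v1].
  by apply: complexI; rewrite -sqnormE mxtrace_mulC vv mxtrace1.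
by rewrite [LHS]mx11_scalar -trace_mx11 mxtrace_mulC sqnormE v1.
Qed.

Lemma unit_col_adj m (P : 'M[C]_m) k : P \is unitarymx -> unit_vector (col k (P^t*)).
Proof.
move=> Pu; apply/unit_vectorP; rewrite -sqnorm_adj; apply: complexI.
have PPkk : (P *m P^t*) k k = 1 by rewrite (unitarymxP Pu) mxE eqxx.
rewrite -sqnormE trace_mx11; apply: etrans PPkk.
by rewrite !mxE; apply: eq_bigr => j _; rewrite !mxE conjCK.
Qed.

Lemma adjmxZ (c : R) m n (X : 'M[C]_(m, n)) : (c%:C *: X)^t* = c%:C *: X^t*.
Proof.
apply/matrixP => i j; rewrite !mxE rmorphM; congr (_ * _).
exact: conjc_real.
Qed.

Lemma sqrtrV_sqr (s : R) : 0 < s -> (Num.sqrt s)^-1 ^+ 2 = s^-1.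
Proof. by move=> s0; rewrite exprVn sqr_sqrtr// ltW. Qed.

Section Exponent.
Variable w : R.
Hypotheses (w_gt0 : 0 < w) (w_le1 : w <= 1).

(** The eigenvalues lie in [0, 1] and sum to 1, and x <= x^w there. This keeps the base of the outer
    power nonnegative, where it is increasing. *)
Lemma trpow_ge1 m n (Y : 'M[C]_(m, n)) :
  sqnorm Y = 1 -> 1 <= trpow w (Y *m Y^t*).
Proof.
move=> Y1; rewrite trpow_rowsq.
have Pu := unitary_adjmul (spectral_unitarymx (Y *m Y^t*)).
rewrite -{1}Y1 -(sqnorm_isom _ Pu); apply: ler_sum => k _.
set x := rowsq _ k; have x0 : 0 <= x := rowsq_ge0 _ _.
have x1 : x <= 1.
  rewrite -Y1 -(sqnorm_isom _ Pu) /sqnorm (bigD1 k)//= lerDl.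
  by apply: sumr_ge0 => i _; exact: rowsq_ge0.
have [->|xn0] := eqVneq x 0; first by rewrite powR0 ?gt_eqF.
by rewrite ger1_powR// lt_neqAle eq_sym xn0 x0.
Qed.

Definition Gmx m n (Y : 'M[C]_(m, n)) : R := (trpow w (Y *m Y^t*) - 1) `^ w.

Lemma Gmx_adj m n (Y : 'M[C]_(m, n)) : Gmx (Y^t*) = Gmx Y.
Proof. by rewrite /Gmx trmxCK trpow_adj. Qed.

(* The extension of [Gmx] from unit vectors to all vectors which is
   homogeneous of degree 1 in the projector; it is 0 at 0. *)
Definition Gmxh m n (Y : 'M[C]_(m, n)) : R :=
  sqnorm Y * Gmx ((Num.sqrt (sqnorm Y))^-1%:C *: Y).

Lemma Gmxh_adj m n (Y : 'M[C]_(m, n)) : Gmxh (Y^t*) = Gmxh Y.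
Proof. by rewrite /Gmxh sqnorm_adj -adjmxZ Gmx_adj. Qed.

(** Scalar core of the concavity: [r j i] is the unnormalised weight of branch j on basis vector i,
    [mu] the spectrum of the mixture, [t j] the trace of the power for branch j. Jensen is used
    twice: over j for the outer power, then over j for each fixed i. *)
Lemma powR_concave_mixture (I J : finType) (r : J -> I -> R) (mu : I -> R)
    (t : J -> R) (T : R) :
  (forall j i, 0 <= r j i) -> (forall i, \sum_j r j i = mu i) ->
  \sum_i mu i = 1 ->
  (forall j, 0 < \sum_i r j i ->
     1 <= t j /\ t j <= \sum_i (r j i / \sum_i' r j i') `^ w) ->
  \sum_i mu i `^ w <= T ->
  \sum_j (\sum_i r j i) * (t j - 1) `^ w <= (T - 1) `^ w.
Proof.
move=> r0 rmu mu1 tP muT; pose p j := \sum_i r j i.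
have p0 j : 0 <= p j by apply: sumr_ge0.
have p1 : \sum_j p j = 1.
  by rewrite -mu1 exchange_big/=; apply: eq_bigr => i _; exact: rmu.
(* Nothing is known of [t j] on branches of probability 0, while Jensen requires nonnegative points;
   there the value 0 is harmless. *)
pose x j := if 0 < p j then t j - 1 else 0.
have x0 j : 0 <= x j by rewrite /x; case: ifP => // /tP[? _]; rewrite subr_ge0.
have pn0 j : ~~ (0 < p j) -> p j = 0.
  by rewrite lt_neqAle p0 andbT negbK eq_sym => /eqP.
rewrite (eq_bigr (fun j => p j * x j `^ w)); last first.
  by move=> j _; rewrite /x -/(p j); case: ifPn => // /pn0 ->; rewrite !mul0r.
apply: le_trans (powR_jensen w_gt0 w_le1 p0 _ x0) _; first by rewrite p1.
have mu_ge1 : 1 <= \sum_i mu i `^ w.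
  rewrite -{1}mu1; apply: ler_sum => i _.
  have mu0 k : 0 <= mu k by rewrite -rmu sumr_ge0.
  have mui1 : mu i <= 1 by rewrite -mu1 (bigD1 i)//= lerDl sumr_ge0.
  have [->|mn0] := eqVneq (mu i) 0; first by rewrite powR0 ?gt_eqF.
  by rewrite ger1_powR// lt_neqAle eq_sym mn0 mu0.
have xs0 : 0 <= \sum_j p j * x j by apply: sumr_ge0 => j _; rewrite mulr_ge0.
apply: ge0_ler_powR; rewrite ?nnegrE ?(ltW w_gt0)//; first lra.
suff : \sum_j p j * (x j + 1) <= \sum_i mu i `^ w.
  rewrite (eq_bigr (fun j => p j * x j + p j)); last by move=> j _; ring.
  rewrite big_split/= p1; lra.
apply: (@le_trans _ _ (\sum_j \sum_i p j * (r j i / p j) `^ w)).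
  apply: ler_sum => j _; rewrite -mulr_sumr /x; case: ifPn => [pj|/pn0 ->].
    by rewrite ler_wpM2l// subrK; have [] := tP _ pj.
  by rewrite !mul0r.
rewrite exchange_big/=; apply: ler_sum => i _.
apply: le_trans (powR_jensen w_gt0 w_le1 p0 _ _) _; first by rewrite p1.
  by move=> j; rewrite divr_ge0.
rewrite -rmu (eq_bigr (fun j => r j i))// => j _.
have [pj|/pn0 pj] := boolP (0 < p j); first by rewrite mulrC divfK// gt_eqF.
by rewrite pj mul0r; apply/esym/(psumr_eq0P _ pj).
Qed.

(** All branches are measured in the eigenbasis of the mixture Y Y^*. In it the trace of the power
    is exact for [Y], and for each [Z j] it is bounded above by [trpow_le_rowsq], which is the
    direction needed. *)
Lemma Gmxh_concave (J : finType) (a b : nat) (d : J -> nat)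
    (Y : 'M[C]_(a, b)) (Z : forall j, 'M[C]_(a, d j)) :
  sqnorm Y = 1 -> \sum_j Z j *m (Z j)^t* = Y *m Y^t* ->
  \sum_j Gmxh (Z j) <= Gmx Y.
Proof.
move=> Y1 ZY; pose P := spectralmx (Y *m Y^t*).
have Pu : P \is unitarymx := spectral_unitarymx _.
have PP := unitary_adjmul Pu.
have pE j : sqnorm (Z j) = \sum_i rowsq (P *m Z j) i by rewrite -(sqnorm_isom _ PP).
rewrite /Gmxh /Gmx (eq_bigr (fun j => (\sum_i rowsq (P *m Z j) i) * (trpow w
   (((Num.sqrt (sqnorm (Z j)))^-1%:C *: Z j) *m
   ((Num.sqrt (sqnorm (Z j)))^-1%:C *: Z j)^t*) - 1) `^ w)); last first.
  by move=> j _; rewrite pE.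
apply: (powR_concave_mixture (mu := fun i => rowsq (P *m Y) i)).
- by move=> j i; exact: rowsq_ge0.
- move=> i; apply: complexI; rewrite rmorph_sum/= -rowsqE.
  rewrite adjmxM mulmxA -(mulmxA P) -ZY mulmx_sumr mulmx_suml summxE.
  by apply: eq_bigr => j _; rewrite -rowsqE adjmxM !mulmxA.
- by rewrite -Y1 -(sqnorm_isom _ PP).
- move=> j pj; split.
    apply: trpow_ge1; rewrite sqnormZ pE sqrtrV_sqr// mulVf// gt_eqF//.
  apply: le_trans (trpow_le_rowsq w_gt0 w_le1 _ Pu) _.
  apply: ler_sum => i _; rewrite -scalemxAr rowsqZ pE sqrtrV_sqr//.
  by rewrite mulrC.
by rewrite trpow_rowsq.
Qed.

End Exponent.

(** * Coefficient matrices of bipartite vectors *)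

Lemma sum_mxtens (V : nmodType) m n (F : 'I_(m * n) -> V) :
  \sum_k F k = \sum_i \sum_j F (mxtens_index (i, j)).
Proof.
rewrite pair_big/= (reindex (@mxtens_index m n))/=; last first.
  by exists (@mxtens_unindex m n) => ? _; rewrite ?mxtens_indexK ?mxtens_unindexK.
by apply: eq_bigr => -[i j].
Qed.

(** In this form the reduced state of A is a Gram matrix, an operator on A multiplies from the left,
    and the transpose of an operator on B multiplies from the right. *)
Definition coefmx m n (v : 'cV[C]_(m * n)) : 'M[C]_(m, n) :=
  \matrix_(i, j) v (mxtens_index (i, j)) 0.

Lemma ptraceB_projector m n (v : 'cV[C]_(m * n)) :
  ptraceB (projector v) = coefmx v *m (coefmx v)^t*.
Proof.
apply/matrixP => i j; rewrite !mxE; apply: eq_bigr => k _.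
by rewrite !mxE big_ord_recl big_ord0 addr0 !mxE.
Qed.

Lemma Gconcurrence_pureE w m n (v : 'cV[C]_(m * n)) :
  Gconcurrence_pure w v = Gmx w (coefmx v).
Proof. by rewrite /Gconcurrence_pure ptraceB_projector trpowE. Qed.

Lemma sqnorm_coefmx m n (v : 'cV[C]_(m * n)) : sqnorm (coefmx v) = sqnorm v.
Proof.
rewrite /sqnorm /rowsq sum_mxtens; apply: eq_bigr => i _; apply: eq_bigr => j _.
by rewrite mxE big_ord_recl big_ord0 addr0.
Qed.

Lemma coefmxZ m n c (v : 'cV[C]_(m * n)) : coefmx (c *: v) = c *: coefmx v.
Proof. by apply/matrixP => i j; rewrite !mxE. Qed.

Lemma coefmx_tens1 m n p (M : 'M[C]_(p, m)) (v : 'cV[C]_(m * n)) :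
  coefmx ((M *t (1%:M : 'M[C]_n)) *m v) = M *m coefmx v.
Proof.
apply/matrixP => i j; rewrite !mxE sum_mxtens; apply: eq_bigr => k _.
rewrite (bigD1 j)//= big1 ?addr0 => [|l lj].
  by rewrite tensmxE !mxE eqxx mulr1.
by rewrite tensmxE !mxE eq_sym (negbTE lj) mulr0 mul0r.
Qed.

Lemma coefmx_1tens m n p (N : 'M[C]_(p, n)) (v : 'cV[C]_(m * n)) :
  coefmx (((1%:M : 'M[C]_m) *t N) *m v) = coefmx v *m N^T.
Proof.
apply/matrixP => i j; rewrite !mxE sum_mxtens (bigD1 i)//= [X in _ + X]big1 ?addr0.
  by apply: eq_bigr => k _; rewrite tensmxE !mxE eqxx mul1r mulrC.
move=> k ki; apply: big1 => l _.
by rewrite tensmxE !mxE eq_sym (negbTE ki) !mul0r.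
Qed.

(** * One local operation on a pure state *)

Section LocalStep.
Variable w : R.
Hypotheses (w_gt0 : 0 < w) (w_le1 : w <= 1).

(** Acting on A splits Y^* Y, which carries the reduced state of B, into the Gram matrices of the
    branches; hence concavity is applied to the adjoints. *)
Lemma Gpure_stepA (J : finType) m n (d : J -> nat)
    (M : forall j, 'M[C]_(d j, m)) (v : 'cV[C]_(m * n)) :
  unit_vector v -> \sum_j (M j)^t* *m M j = 1%:M ->
  \sum_j Gmxh w (coefmx ((M j *t (1%:M : 'M[C]_n)) *m v)) <=
  Gconcurrence_pure w v.
Proof.
move=> /unit_vectorP v1 M1; rewrite Gconcurrence_pureE.
rewrite -(Gmx_adj w_gt0 w_le1 (coefmx v)).
rewrite (eq_bigr (fun j => Gmxh w ((M j *m coefmx v)^t*))); last first.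
  by move=> j _; rewrite coefmx_tens1 -(Gmxh_adj w_gt0 w_le1 (M j *m coefmx v)).
apply: Gmxh_concave => //; first by rewrite sqnorm_adj sqnorm_coefmx.
rewrite (eq_bigr (fun j => (coefmx v)^t* *m ((M j)^t* *m M j) *m coefmx v)).
  by rewrite -mulmx_suml -mulmx_sumr M1 mulmx1 trmxCK.
by move=> j _; rewrite trmxCK adjmxM !mulmxA.
Qed.

(** Here Y Y^*, the reduced state of A, is split, so no adjoint is taken. The transposes come from
    the right action of [N j] on coefficient matrices. *)
Lemma Gpure_stepB (J : finType) m n (d : J -> nat)
    (N : forall j, 'M[C]_(d j, n)) (v : 'cV[C]_(m * n)) :
  unit_vector v -> \sum_j (N j)^t* *m N j = 1%:M ->
  \sum_j Gmxh w (coefmx (((1%:M : 'M[C]_m) *t N j) *m v)) <=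
  Gconcurrence_pure w v.
Proof.
move=> /unit_vectorP v1 N1; rewrite Gconcurrence_pureE.
rewrite (eq_bigr (fun j => Gmxh w (coefmx v *m (N j)^T))); last first.
  by move=> j _; rewrite coefmx_1tens.
apply: Gmxh_concave => //; first by rewrite sqnorm_coefmx.
rewrite (eq_bigr (fun j => coefmx v *m ((N j)^t* *m N j)^T *m (coefmx v)^t*)).
  rewrite -mulmx_suml -mulmx_sumr -[in LHS](linear_sum (@trmx _ _ _)).
  by rewrite N1 /= tr_scalar_mx mulmx1.
move=> j _; rewrite adjmxM trmx_mul !mulmxA; congr (_ *m _ *m _).
by apply/matrixP => a b; rewrite !mxE.
Qed.

End LocalStep.
End PureState.

(** * The convex roof and LOCC *)

Section Ensembles.
Variables (R : realType) (w : R).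
Hypotheses (w_gt0 : 0 < w) (w_le1 : w <= 1).
Local Notation C := R[i].

Lemma Gconcurrence_pure_ge0 m n (v : 'cV[C]_(m * n)) :
  0 <= Gconcurrence_pure w v.
Proof. exact: powR_ge0. Qed.

(* [X] need not have trace 1: this is what makes the relation stable under the
   unnormalised branches of an LOCC protocol. *)
Inductive ens (m n : nat) : 'M[C]_(m * n) -> R -> Prop :=
| ens_nil : ens 0 0
| ens_cons (p : R) phi X c : 0 <= p -> unit_vector phi -> ens X c ->
    ens (p%:C *: projector phi + X) (p * Gconcurrence_pure w phi + c).

Lemma ens_ge0 m n (X : 'M[C]_(m * n)) c : ens X c -> 0 <= c.
Proof.
elim=> // p phi Y d p0 _ _ d0.
by rewrite addr_ge0// mulr_ge0// Gconcurrence_pure_ge0.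
Qed.

Lemma ensD m n (X Y : 'M[C]_(m * n)) c d :
  ens X c -> ens Y d -> ens (X + Y) (c + d).
Proof.
move=> eX eY; elim: eX => [|p phi Z e p0 phi1 _ IH]; first by rewrite !add0r.
by rewrite -!addrA; apply: ens_cons.
Qed.

Lemma ensZ m n a (X : 'M[C]_(m * n)) c :
  0 <= a -> ens X c -> ens (a%:C *: X) (a * c).
Proof.
move=> a0; elim=> [|p phi Z e p0 phi1 _ IH].
  by rewrite scaler0 mulr0; exact: ens_nil.
rewrite scalerDr mulrDr scalerA -rmorphM mulrA.
by apply: ens_cons => //; rewrite mulr_ge0.
Qed.

Lemma ens_sum m n (I : Type) (r : seq I) (X : I -> 'M[C]_(m * n)) c :
  (forall i, ens (X i) (c i)) -> ens (\sum_(i <- r) X i) (\sum_(i <- r) c i).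
Proof.
move=> Xc; apply: (big_ind2 (fun A x => ens A x)) => //.
  exact: ens_nil.
by move=> *; exact: ensD.
Qed.

Lemma ens_unit m n (v : 'cV[C]_(m * n)) :
  unit_vector v -> ens (projector v) (Gconcurrence_pure w v).
Proof.
move=> v1; rewrite -[projector v]addr0 -[projector v]scale1r.
rewrite -[Gconcurrence_pure w v]addr0 -[Gconcurrence_pure w v]mul1r.
by apply: (@ens_cons m n 1) => //; exact: ens_nil.
Qed.

(** A nonzero vector is normalised and its squared norm becomes the weight; the zero vector gets the
    empty decomposition. *)
Lemma ens_projector m n (v : 'cV[C]_(m * n)) :
  ens (projector v) (Gmxh w (coefmx v)).
Proof.
rewrite /Gmxh sqnorm_coefmx -coefmxZ -Gconcurrence_pureE.
have [v0|vn0] := eqVneq (sqnorm v) 0.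
  rewrite v0 mul0r (sqnorm_eq0 v0) /projector mul0mx; exact: ens_nil.
have v_gt0 : 0 < sqnorm v by rewrite lt_neqAle eq_sym vn0 sqnorm_ge0.
set u := _ *: v.
have -> : projector v = (sqnorm v)%:C *: projector u.
  rewrite /projector /u adjmxZ -scalemxAl -scalemxAr !scalerA -!rmorphM.
  by rewrite -mulrA -expr2 sqrtrV_sqr// mulfV// scale1r.
apply: ensZ; first exact: sqnorm_ge0.
by apply/ens_unit/unit_vectorP; rewrite sqnormZ sqrtrV_sqr// mulVf.
Qed.

Lemma ens_pure_decomposition m n (rho : 'M[C]_(m * n)) K (p : 'I_K -> R) phi :
  pure_decomposition rho p phi ->
  ens rho (\sum_k p k * Gconcurrence_pure w (phi k)).
Proof.
case=> -[p0 _] phi1 ->; apply: ens_sum => k; apply: ensZ => //.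
exact: ens_unit.
Qed.

Lemma trace_projector d (v : 'cV[C]_d) : unit_vector v -> \tr (projector v) = 1.
Proof. by move=> /unit_vectorP v1; rewrite /projector sqnormE v1. Qed.

Lemma trace_mixture d K (p : 'I_K -> R) (phi : 'I_K -> 'cV[C]_d) :
  (forall k, unit_vector (phi k)) ->
  \tr (\sum_k (p k)%:C *: projector (phi k)) = (\sum_k p k)%:C.
Proof.
move=> phi1; rewrite raddf_sum rmorph_sum; apply: eq_bigr => k _ /=.
by rewrite linearZ/= trace_projector// mulr1.
Qed.

(** Unit trace turns the unconstrained weights of [ens] into a probability vector. *)
Lemma pure_decomposition_ens m n (rho : 'M[C]_(m * n)) c :
  ens rho c -> \tr rho = 1 ->
  exists K (p : 'I_K -> R) phi, pure_decomposition rho p phi /\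
    c = \sum_k p k * Gconcurrence_pure w (phi k).
Proof.
move=> rc rho1; suff [K [p [phi [p0 phi1 rE cE]]]] :
  exists K (p : 'I_K -> R) (phi : 'I_K -> 'cV[C]_(m * n)),
  [/\ forall k, 0 <= p k, forall k, unit_vector (phi k),
      rho = \sum_k (p k)%:C *: projector (phi k)
    & c = \sum_k p k * Gconcurrence_pure w (phi k)].
  exists K, p, phi; split=> //; split=> //; split=> //.
  by apply: complexI; rewrite -(trace_mixture p phi1) -rE rho1.
elim: rc {rho1} => [|q psi X d q0 psi1 _ [K [p [phi [p0 phi1 -> ->]]]]].
  exists 0%N, (fun=> 0), (fun=> 0); split=> //.
  - by case.
  - by rewrite big_ord0.
  - by rewrite big_ord0.
exists K.+1, (fun i => if unlift ord0 i is Some j then p j else q),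
  (fun i => if unlift ord0 i is Some j then phi j else psi); split.
- by move=> i; case: unliftP.
- by move=> i; case: unliftP.
- rewrite big_ord_recl unlift_none; congr (_ + _).
  by apply: eq_bigr => i _; rewrite liftK.
- move: (@Gconcurrence_pure R m n w) => G.
  rewrite [RHS]big_ord_recl unlift_none; congr (_ + _).
  by apply: eq_bigr => i _; rewrite liftK.
Qed.

(** The costs are bounded below by 0, so their infimum is at most each of them. *)
Lemma Gconcurrence_le_ens m n (rho : 'M[C]_(m * n)) c :
  ens rho c -> \tr rho = 1 -> Gconcurrence w rho <= c.
Proof.
move=> rc rho1; have [K [p [phi [dec ->]]]] := pure_decomposition_ens rc rho1.
apply: ge_inf; last by exists K, p, phi.
exists 0 => _ [L [q [psi [qdec ->]]]].
exact: ens_ge0 (ens_pure_decomposition qdec).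
Qed.

Lemma Gconcurrence_ge_ens m n (rho : 'M[C]_(m * n)) x :
  \tr rho = 1 -> (exists c, ens rho c) ->
  (forall c, ens rho c -> x <= c) -> x <= Gconcurrence w rho.
Proof.
move=> rho1 [c rc] xle; apply: lb_le_inf.
  have [K [p [phi dec]]] := pure_decomposition_ens rc rho1.
  by exists c, K, p, phi.
by move=> _ [K [p [phi [dec ->]]]]; apply/xle/ens_pure_decomposition.
Qed.

(** Near-optimal decompositions, used below in place of an optimal one. *)
Lemma Gconcurrence_ens_lt m n (rho : 'M[C]_(m * n)) x :
  \tr rho = 1 -> (exists c, ens rho c) -> Gconcurrence w rho < x ->
  exists2 c, ens rho c & c < x.
Proof.
move=> rho1 rc ltx; apply: contrapT => nex.
suff : x <= Gconcurrence w rho by rewrite leNgt ltx.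
apply: Gconcurrence_ge_ens => // c ec; rewrite leNgt; apply/negP => cx.
by apply: nex; exists c.
Qed.

(** The spectral decomposition, with the columns of P^* as eigenvectors. Each eigenvalue is the
    value of the quadratic form at one of them, hence real and nonnegative. *)
Lemma density_pure_decomposition d (rho : 'M[C]_d) : density rho ->
  exists K (p : 'I_K -> R) phi, pure_decomposition rho p phi.
Proof.
case=> rJ rpos rho1; set P := spectralmx rho.
have Pu : P \is unitarymx := spectral_unitarymx rho.
have rn : rho \is normalmx by apply/normalmxP; rewrite rJ.
have sE k : 0 <= spectral_diag rho 0 k.
  have := rpos ((row k P)^t*); rewrite trmxCK -row_mul.
  have /matrixP/(_ k k) := normal_spectralE rn.
  rewrite [in X in _ = X -> _]mxE eqxx mulr1n => <-.
  by rewrite -/P !mxE; congr (0 <= _); apply: eq_bigr => j _; rewrite !mxE.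
have sR k : (complex.Re (spectral_diag rho 0 k))%:C = spectral_diag rho 0 k.
  by rewrite RRe_real// ger0_real.
pose phi k : 'cV[C]_d := col k (P^t*).
have phi1 k : unit_vector (phi k) := unit_col_adj k Pu.
have rE : rho = \sum_k (complex.Re (spectral_diag rho 0 k))%:C *: projector (phi k).
  have /orthomx_spectralP {1}-> := rn; rewrite -/P invmx_unitary//.
  apply/matrixP => i j; rewrite summxE mxE; apply: eq_bigr => k _.
  rewrite sR mul_mx_diag !mxE big_ord_recl big_ord0 addr0 !mxE conjCK.
  by rewrite mulrCA mulrA.
exists d, (fun k => complex.Re (spectral_diag rho 0 k)), phi; split=> //; split.
  by move=> k; rewrite -ler0c sR.
by apply: complexI; rewrite -(trace_mixture _ phi1) -rE rho1.
Qed.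

Lemma density_ens m n (rho : 'M[C]_(m * n)) : density rho -> exists c, ens rho c.
Proof.
move=> /density_pure_decomposition[K [p [phi /ens_pure_decomposition rc]]].
by eexists; exact: rc.
Qed.

(** * Ensembles under Kraus maps and LOCC protocols *)

Lemma krausD d d' (E : seq 'M[C]_(d', d)) X Y :
  kraus E (X + Y) = kraus E X + kraus E Y.
Proof.
by rewrite /kraus -big_split; apply: eq_bigr => M _; rewrite mulmxDr mulmxDl.
Qed.

Lemma krausZ d d' (E : seq 'M[C]_(d', d)) a X : kraus E (a *: X) = a *: kraus E X.
Proof.
rewrite /kraus scaler_sumr; apply: eq_bigr => M _.
by rewrite -scalemxAr -scalemxAl.
Qed.

Lemma kraus_projector d d' (E : seq 'M[C]_(d', d)) v :
  kraus E (projector v) = \sum_(M <- E) projector (M *m v).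
Proof. by apply: eq_bigr => M _; rewrite /projector adjmxM !mulmxA. Qed.

(** Kraus maps are linear, so an inequality for unit vectors extends term by term to decompositions:
    each vector is replaced by its images, with homogeneous cost. *)
Lemma ens_kraus m n K (m' n' : 'I_K -> nat)
    (F : forall k, seq 'M[C]_(m' k * n' k, m * n)) X c :
  (forall v, unit_vector v ->
     \sum_k \sum_(M <- F k) Gmxh w (coefmx (M *m v)) <= Gconcurrence_pure w v) ->
  ens X c ->
  exists2 d : 'I_K -> R, forall k, ens (kraus (F k) X) (d k) & \sum_k d k <= c.
Proof.
move=> FG; elim=> [|p phi Y e p0 phi1 _ [d dE dle]].
  exists (fun=> 0); last by rewrite big1.
  move=> k; rewrite /kraus big1; first exact: ens_nil.
  by move=> M _; rewrite mulmx0 mul0mx.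
exists (fun k => p * \sum_(M <- F k) Gmxh w (coefmx (M *m phi)) + d k).
  move=> k; rewrite krausD krausZ kraus_projector; apply: ensD => //.
  by apply: ensZ => //; apply: ens_sum => M; exact: ens_projector.
by rewrite big_split/= -mulr_sumr lerD// ler_wpM2l// FG.
Qed.

(** Gathers the Kraus operators of all outcomes into one finite family, the form expected by
    [Gpure_stepA] and [Gpure_stepB]; each operator is then treated as an outcome of its own. *)
Lemma sum_tagged_seq (V : nmodType) K (T : 'I_K -> Type)
    (E : forall k, seq (T k)) (F : forall k, T k -> V) :
  \sum_k \sum_(M <- E k) F k M =
  \sum_(x : {k : 'I_K & 'I_(size (E k))})
    F (tag x) (tnth (in_tuple (E (tag x))) (tagged x)).
Proof.
rewrite (eq_bigr (fun k => \sum_(i < size (E k)) F k (tnth (in_tuple (E k)) i))).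
  exact: (sig_big_dep xpredT (fun=> xpredT)
    (fun k i => F k (tnth (in_tuple (E k)) i))).
by move=> k _; rewrite big_tnth.
Qed.

Lemma ens_local_A m n K (m' : 'I_K -> nat) (E : forall k, seq 'M[C]_(m' k, m))
    (X : 'M[C]_(m * n)) c :
  local_instrument E -> ens X c ->
  exists2 d : 'I_K -> R,
    forall k, ens (kraus [seq M *t (1%:M : 'M[C]_n) | M <- E k] X) (d k)
  & \sum_k d k <= c.
Proof.
rewrite /local_instrument sum_tagged_seq => E1; apply: ens_kraus => v v1.
under eq_bigr => k _ do rewrite big_map.
rewrite (sum_tagged_seq _ (fun k M => Gmxh w (coefmx ((M *t 1%:M) *m v)))).
exact: (Gpure_stepA w_gt0 w_le1 v1 E1).
Qed.

Lemma ens_local_B m n K (n' : 'I_K -> nat) (E : forall k, seq 'M[C]_(n' k, n))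
    (X : 'M[C]_(m * n)) c :
  local_instrument E -> ens X c ->
  exists2 d : 'I_K -> R,
    forall k, ens (kraus [seq (1%:M : 'M[C]_m) *t M | M <- E k] X) (d k)
  & \sum_k d k <= c.
Proof.
rewrite /local_instrument sum_tagged_seq => E1; apply: ens_kraus => v v1.
under eq_bigr => k _ do rewrite big_map.
rewrite (sum_tagged_seq _ (fun k M => Gmxh w (coefmx ((1%:M *t M) *m v)))).
exact: (Gpure_stepB w_gt0 w_le1 v1 E1).
Qed.

(** Induction on the protocol tree: each local operation distributes the cost over its outcomes
    without increasing the total, and branches with the same label are merged by adding their
    decompositions. *)
Lemma ens_locc (I : finType) dA dB m n (P : locc R I dA dB m n) X c :
  ens X c ->
  exists2 d : I -> R, forall i, ens (locc_branch P i X) (d i) & \sum_i d i <= c.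
Proof.
elim: P X c => [j|a b K a' E E1 next IH|a b K b' E E1 next IH] X c ec /=.
- exists (fun i => if j == i then c else 0).
    by move=> i; case: ifP => // _; exact: ens_nil.
  by rewrite -big_mkcond/= (eq_bigl (pred1 j)) ?big_pred1_eq.
- have [d dE dle] := ens_local_A E1 ec.
  have /fin_all_exists2[f fE fle] : forall k, exists2 f : I -> R,
      forall i, ens (locc_branch (next k) i
        (kraus [seq M *t (1%:M : 'M[C]_b) | M <- E k] X)) (f i)
    & \sum_i f i <= d k by move=> k; exact: IH.
  exists (fun i => \sum_k f k i); first by move=> i; exact: ens_sum.
  by rewrite exchange_big/=; apply: le_trans dle; exact: ler_sum.
- have [d dE dle] := ens_local_B E1 ec.
  have /fin_all_exists2[f fE fle] : forall k, exists2 f : I -> R,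
      forall i, ens (locc_branch (next k) i
        (kraus [seq (1%:M : 'M[C]_a) *t M | M <- E k] X)) (f i)
    & \sum_i f i <= d k by move=> k; exact: IH.
  exists (fun i => \sum_k f k i); first by move=> i; exact: ens_sum.
  by rewrite exchange_big/=; apply: le_trans dle; exact: ler_sum.
Qed.

Lemma trace_kraus_instrument d K (d' : 'I_K -> nat)
    (E : forall k, seq 'M[C]_(d' k, d)) X :
  local_instrument E -> \sum_k \tr (kraus (E k) X) = \tr X.
Proof.
move=> E1; rewrite -[in RHS](mul1mx X) -E1 mulmx_suml raddf_sum.
apply: eq_bigr => k _ /=; rewrite mulmx_suml !raddf_sum.
by apply: eq_bigr => M _ /=; rewrite mxtrace_mulC mulmxA.
Qed.

Lemma adjmx_tens a b p q (A : 'M[C]_(a, b)) (B : 'M[C]_(p, q)) :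
  (A *t B)^t* = A^t* *t B^t*.
Proof. by rewrite trmx_tens map_mxT. Qed.

Lemma adjmx1 d : (1%:M : 'M[C]_d)^t* = 1%:M.
Proof. by rewrite tr_scalar_mx map_scalar_mx rmorph1. Qed.

Lemma tensmx11 a b : (1%:M : 'M[C]_a) *t (1%:M : 'M[C]_b) = 1%:M.
Proof.
apply/matrixP => x y; case: (mxtens_indexP x) => i j.
case: (mxtens_indexP y) => k l; rewrite tensmxE !mxE.
rewrite (inj_eq (can_inj (@mxtens_indexK a b))) xpair_eqE.
by case: (i == k); case: (j == l); rewrite ?mulr1 ?mulr0.
Qed.

Lemma tensmx_suml (I : Type) (r : seq I) a b p q (A : I -> 'M[C]_(a, b))
    (B : 'M[C]_(p, q)) :
  (\sum_(i <- r) A i) *t B = \sum_(i <- r) A i *t B.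
Proof.
apply: (big_morph (fun X => X *t B)); last exact: tens0mx.
by move=> X Y; apply/matrixP => i j; rewrite !mxE mulrDl.
Qed.

Lemma tensmx_sumr (I : Type) (r : seq I) a b p q (A : I -> 'M[C]_(a, b))
    (B : 'M[C]_(p, q)) :
  B *t (\sum_(i <- r) A i) = \sum_(i <- r) B *t A i.
Proof.
apply: (big_morph (fun X => B *t X)); last exact: tensmx0.
by move=> X Y; apply/matrixP => i j; rewrite !mxE mulrDr.
Qed.

Lemma local_instrument_tens1 m n K (m' : 'I_K -> nat)
    (E : forall k, seq 'M[C]_(m' k, m)) : local_instrument E ->
  local_instrument (fun k => [seq M *t (1%:M : 'M[C]_n) | M <- E k]).
Proof.
rewrite /local_instrument => E1; rewrite -tensmx11 -[in RHS]E1 tensmx_suml.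
apply: eq_bigr => k _; rewrite tensmx_suml big_map; apply: eq_bigr => M _.
by rewrite adjmx_tens tensmx_mul adjmx1 mulmx1.
Qed.

Lemma local_instrument_1tens m n K (n' : 'I_K -> nat)
    (E : forall k, seq 'M[C]_(n' k, n)) : local_instrument E ->
  local_instrument (fun k => [seq (1%:M : 'M[C]_m) *t M | M <- E k]).
Proof.
rewrite /local_instrument => E1; rewrite -tensmx11 -[in X in _ *t X]E1 tensmx_sumr.
apply: eq_bigr => k _; rewrite tensmx_sumr big_map; apply: eq_bigr => M _.
by rewrite adjmx_tens tensmx_mul adjmx1 mulmx1.
Qed.

Lemma trace_locc_average (I : finType) dA dB m n (P : locc R I dA dB m n) X :
  \tr (locc_average P X) = \tr X.
Proof.
rewrite /locc_average; elim: P X => [j|a b K a' E E1 next IH|a b K b' E E1 next IH] X /=.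
- by rewrite -big_mkcond/= (eq_bigl (pred1 j)) ?big_pred1_eq.
- rewrite exchange_big/= raddf_sum/= (eq_bigr _ (fun k _ => IH k _)).
  exact: trace_kraus_instrument (local_instrument_tens1 _ E1).
- rewrite exchange_big/= raddf_sum/= (eq_bigr _ (fun k _ => IH k _)).
  exact: trace_kraus_instrument (local_instrument_1tens _ E1).
Qed.

Lemma ens_locc_average (I : finType) dA dB m n (P : locc R I dA dB m n) X c :
  ens X c -> exists2 d, ens (locc_average P X) d & d <= c.
Proof.
by move=> /(ens_locc P)[d dE dle]; exists (\sum_i d i) => //; exact: ens_sum.
Qed.

(** Assuming only unit trace and some decomposition lets the lemma be applied again to the output of
    a protocol, as local unitary invariance requires. *)
Lemma Gconcurrence_locc_average (I : finType) dA dB m n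
    (P : locc R I dA dB m n) rho :
  \tr rho = 1 -> (exists c, ens rho c) ->
  Gconcurrence w (locc_average P rho) <= Gconcurrence w rho.
Proof.
move=> rho1 rc; apply: Gconcurrence_ge_ens => // c /(ens_locc_average P)[d ed].
by apply: le_trans; apply: Gconcurrence_le_ens; rewrite ?trace_locc_average.
Qed.

Lemma Gconcurrence_locc_ensemble (I : finType) dA dB m n
    (P : locc R I dA dB m n) rho (p : I -> R) sigma :
  density rho -> locc_ensemble P rho p sigma ->
  \sum_i p i * Gconcurrence w (sigma i) <= Gconcurrence w rho.
Proof.
move=> rd Pps; have [_ _ rho1] := rd.
apply: Gconcurrence_ge_ens => //; first exact: density_ens.
move=> c /(ens_locc P)[d dE]; apply: le_trans; apply: ler_sum => i _.
have [p0 [_ _ sigma1] bE] := Pps i; have := dE i; rewrite bE => ei.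
(* An outcome of probability 0 adds 0 on the left and a nonnegative cost on the right; any other
   branch is divided by its probability to decompose [sigma i]. *)
have [->|pn0] := eqVneq (p i) 0; first by rewrite mul0r; exact: ens_ge0 ei.
have p_gt0 : 0 < p i by rewrite lt_neqAle eq_sym pn0.
rewrite mulrC -ler_pdivlMr// mulrC; apply: Gconcurrence_le_ens => //.
have := ensZ (a := (p i)^-1) _ ei; rewrite invr_ge0 p0 scalerA -rmorphM mulVf//.
by rewrite scale1r; exact.
Qed.

(** Pool decompositions of the [rhos k] that are optimal up to e; the weights sum to 1, so the total
    excess is at most e. *)
Lemma Gconcurrence_convex m n K (p : 'I_K -> R) (rhos : 'I_K -> 'M[C]_(m * n)) :
  (forall k, 0 < p k) -> \sum_k p k = 1 -> (forall k, density (rhos k)) ->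
  Gconcurrence w (\sum_k (p k)%:C *: rhos k) <=
  \sum_k p k * Gconcurrence w (rhos k).
Proof.
move=> p0 p1 rd; apply/ler_addgt0Pr => e e0.
have /fin_all_exists2[c cE cle] : forall k, exists2 c, ens (rhos k) c
    & c < Gconcurrence w (rhos k) + e.
  move=> k; have [_ _ r1] := rd k.
  by apply: Gconcurrence_ens_lt; rewrite ?ltrDl//; exact: density_ens.
apply: (@le_trans _ _ (\sum_k p k * c k)).
  apply: Gconcurrence_le_ens; first by apply: ens_sum => k; apply: ensZ => //; exact: ltW.
  rewrite raddf_sum -[RHS](rmorph1 (real_complex R)) -p1 rmorph_sum.
  apply: eq_bigr => k _ /=; have [_ _ r1] := rd k.
  by rewrite linearZ/= r1 mulr1.
rewrite -[e in leRHS]mul1r -p1 mulr_suml -big_split/=; apply: ler_sum => k _.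
by rewrite -mulrDr ler_wpM2l// ltW.
Qed.

(** * Local unitaries as LOCC protocols *)

Section LocalUnitary.
Variables (m n : nat) (UA : 'M[C]_m) (UB : 'M[C]_n).
Hypotheses (UA1 : UA \is unitarymx) (UB1 : UB \is unitarymx).

Lemma local_instrument_unitary d (U : 'M[C]_d) : U \is unitarymx ->
  local_instrument (fun _ : 'I_1 => [:: U]).
Proof. by move=> U1; rewrite /local_instrument big_ord1 big_seq1 unitary_adjmul. Qed.

Definition locc_unitary : locc R unit m n m n :=
  LoccA (local_instrument_unitary UA1) (fun _ =>
  LoccB (local_instrument_unitary UB1) (fun _ => LoccDone R m n tt)).

Lemma locc_average_unitary X :
  locc_average locc_unitary X = (UA *t UB) *m X *m (UA^t* *t UB^t*).
Proof.
rewrite /locc_average (big_pred1 tt)/=; last by case.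
rewrite !big_ord1 /kraus /= !big_seq1 !adjmx_tens !adjmx1 !mulmxA.
by rewrite tensmx_mul mul1mx mulmx1 -!mulmxA tensmx_mul mul1mx mulmx1.
Qed.

End LocalUnitary.

(** A local unitary and its inverse are both LOCC protocols, so monotonicity yields both
    inequalities. *)
Lemma Gconcurrence_local_unitary m n (UA : 'M[C]_m) (UB : 'M[C]_n) rho :
  UA \is unitarymx -> UB \is unitarymx -> density rho ->
  Gconcurrence w rho =
  Gconcurrence w ((UA *t UB) *m rho *m (UA^t* *t UB^t*)).
Proof.
move=> UA1 UB1 rd; have [_ _ rho1] := rd; have [c rc] := density_ens rd.
apply/eqP; rewrite eq_le -(locc_average_unitary UA1 UB1).
rewrite Gconcurrence_locc_average ?andbT//; last by exists c.
have VA1 : UA^t* \is unitarymx by rewrite trmxC_unitary.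
have VB1 : UB^t* \is unitarymx by rewrite trmxC_unitary.
have {1}<- : locc_average (locc_unitary VA1 VB1)
    (locc_average (locc_unitary UA1 UB1) rho) = rho.
  rewrite !locc_average_unitary !trmxCK !mulmxA tensmx_mul.
  rewrite -!mulmxA tensmx_mul !unitary_adjmul// !tensmx11.
  by rewrite mulmx1 mul1mx.
apply: Gconcurrence_locc_average; first by rewrite trace_locc_average.
by have [d ed _] := ens_locc_average (locc_unitary UA1 UB1) rc; exists d.
Qed.

End Ensembles.

(** * Faithfulness *)

Section Product.
Variables (R : realType).
Local Notation C := R[i].

Definition prodvec m n (a : 'cV[C]_m) (b : 'cV[C]_n) : 'cV[C]_(m * n) :=
  \col_k (a (mxtens_unindex k).1 0 * b (mxtens_unindex k).2 0).

Lemma coefmx_prodvec m n (a : 'cV[C]_m) (b : 'cV[C]_n) :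
  coefmx (prodvec a b) = a *m b^T.
Proof.
apply/matrixP => i j; rewrite !mxE mxtens_indexK/=.
by rewrite big_ord_recl big_ord0 addr0 !mxE.
Qed.

Lemma coefmx_inj m n : injective (@coefmx R m n).
Proof.
move=> u v /matrixP uv; apply/matrixP => k l; rewrite (ord1 l).
by case: (mxtens_indexP k) => i j; have := uv i j; rewrite !mxE.
Qed.

Lemma projector_prodvec m n (a : 'cV[C]_m) (b : 'cV[C]_n) :
  projector (prodvec a b) = projector a *t projector b.
Proof.
apply/matrixP => k l; case: (mxtens_indexP k) => i j.
case: (mxtens_indexP l) => i' j'; rewrite tensmxE /projector.
rewrite !mxE !big_ord_recl !big_ord0 !addr0 !mxE !mxtens_indexK/= rmorphM.
by rewrite mulrACA.
Qed.

Lemma gram_outer m n (a : 'cV[C]_m) (b : 'cV[C]_n) : unit_vector b ->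
  (a *m b^T) *m (a *m b^T)^t* = a *m a^t*.
Proof.
move=> b1; rewrite adjmxM -mulmxA (mulmxA b^T).
have -> : b^T *m b^T^t* = 1%:M.
  rewrite -(trmx1 _ 1) -b1 trmx_mul; congr (_ *m _).
  by apply/matrixP => i j; rewrite !mxE.
by rewrite mul1mx.
Qed.

Lemma unit_prodvec m n (a : 'cV[C]_m) (b : 'cV[C]_n) :
  unit_vector a -> unit_vector b -> unit_vector (prodvec a b).
Proof.
move=> /unit_vectorP a1 b1; apply/unit_vectorP; rewrite -sqnorm_coefmx.
rewrite coefmx_prodvec; apply: complexI.
by rewrite -sqnormE gram_outer// sqnormE a1.
Qed.

(** The purity of the reduced state: the Frobenius norm is unchanged by the unitary conjugation that
    diagonalises Y Y^*. *)
Lemma sqnorm_gram m n (Y : 'M[C]_(m, n)) :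
  sqnorm (Y *m Y^t*) = \sum_k rowsq (spectralmx (Y *m Y^t*) *m Y) k ^+ 2.
Proof.
set A := Y *m Y^t*; set P := spectralmx A.
have PP := unitary_adjmul (spectral_unitarymx A).
rewrite -(sqnorm_isom _ PP) -sqnorm_adj -(sqnorm_isom _ PP) -sqnorm_adj.
rewrite -/P !adjmxM !trmxCK normal_spectralE ?gram_normal//.
apply: eq_bigr => k _; rewrite /rowsq (bigD1 k)//= big1 ?addr0 => [|j jk].
  by rewrite mxE eqxx mulr1n spectral_diag_gram /sqmod/= expr0n/= addr0.
by rewrite mxE eq_sym (negbTE jk) mulr0n /sqmod/= expr0n/= addr0.
Qed.

Lemma rowsq_le_sqnorm m n (X : 'M[C]_(m, n)) i : rowsq X i <= sqnorm X.
Proof.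
rewrite /sqnorm (bigD1 i)//= lerDl; apply: sumr_ge0 => k _; exact: rowsq_ge0.
Qed.

Lemma sqnorm_gram_le1 m n (Y : 'M[C]_(m, n)) :
  sqnorm Y = 1 -> sqnorm (Y *m Y^t*) <= 1.
Proof.
move=> Y1; rewrite sqnorm_gram; set P := spectralmx _.
have PP : P^t* *m P = 1%:M := unitary_adjmul (spectral_unitarymx _).
rewrite -[leRHS]Y1 -(sqnorm_isom _ PP); apply: ler_sum => k _.
rewrite expr2 ler_piMr ?rowsq_ge0//.
by rewrite -Y1 -(sqnorm_isom _ PP) rowsq_le_sqnorm.
Qed.

(* Purity 1 forces the spectrum of the Gram matrix to be (1, 0, ..., 0). *)
Lemma outer_of_purity1 m n (Y : 'M[C]_(m, n)) :
  sqnorm Y = 1 -> sqnorm (Y *m Y^t*) = 1 ->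
  exists (a : 'cV[C]_m) (b : 'cV[C]_n),
    [/\ unit_vector a, unit_vector b & Y = a *m b^T].
Proof.
move=> Y1; rewrite sqnorm_gram; set P := spectralmx _ => pur1.
have Pu : P \is unitarymx := spectral_unitarymx _.
have PP := unitary_adjmul Pu.
have l1 : \sum_k rowsq (P *m Y) k = 1 by rewrite -Y1 -(sqnorm_isom _ PP).
have lle1 k : rowsq (P *m Y) k <= 1.
  by rewrite -Y1 -(sqnorm_isom _ PP) rowsq_le_sqnorm.
(* These terms are nonnegative and sum to trace minus purity, which is 0; so every eigenvalue is 0
   or 1. *)
have l01 k : rowsq (P *m Y) k * (1 - rowsq (P *m Y) k) = 0.
  have : \sum_k rowsq (P *m Y) k * (1 - rowsq (P *m Y) k) = 0.
    rewrite (eq_bigr (fun k => rowsq (P *m Y) k - rowsq (P *m Y) k ^+ 2)).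
      by rewrite sumrB l1 pur1 subrr.
    by move=> i _; ring.
  move=> /psumr_eq0P; apply=> // i _; by rewrite mulr_ge0 ?rowsq_ge0 ?subr_ge0.
have [k0 k0n] : exists k, rowsq (P *m Y) k != 0.
  apply: contrapT => /forallNP nk; have := l1; rewrite big1 => [/eqP|k _].
    by rewrite eq_sym oner_eq0.
  by apply/eqP/negP => /negP; exact: nk.
have k01 : rowsq (P *m Y) k0 = 1.
  have /eqP := l01 k0; rewrite mulf_eq0 (negbTE k0n)/= subr_eq0 => /eqP.
  exact: esym.
have kn k : k != k0 -> rowsq (P *m Y) k = 0.
  move=> kk0; have : \sum_(i | i != k0) rowsq (P *m Y) i = 0.
    by have := l1; rewrite (bigD1 k0)//= k01; lra.
  by move=> /psumr_eq0P; apply => // i _; exact: rowsq_ge0.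
(* Only row [k0] of P Y is nonzero, so the product of P^* and P Y, which is [Y], reduces to one
   column times one row. *)
exists (col k0 (P^t*)), (row k0 (P *m Y))^T; split.
- exact: unit_col_adj.
- apply/unit_vectorP; rewrite -k01 /sqnorm/rowsq; apply: eq_bigr => j _.
  by rewrite big_ord_recl big_ord0 addr0 !mxE.
rewrite trmxK -{1}(mul1mx Y) -PP -mulmxA; apply/matrixP => i j; rewrite mxE.
rewrite [RHS]mxE big_ord_recl big_ord0 addr0 (bigD1 k0)//= big1 ?addr0.
  by rewrite [col _ _ _ _]mxE [row _ _ _ _]mxE.
move=> k /kn kz; rewrite (_ : (P *m Y) k j = 0) ?mulr0//; apply: sqmod_eq0.
by apply: (psumr_eq0P _ kz) => // l _; exact: sqmod_ge0.
Qed.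

Section Exponent.
Variable w : R.
Hypotheses (w_gt0 : 0 < w) (w_le1 : w <= 1).

(** Write x = s t with s = x^w and t = x^(1 - w). The tangent bound for exponent 1 - w reads t <= 1
    - u with u = (1 - w)(1 - x), hence x (1 + u) <= s (1 - u^2) <= s. *)
Lemma powR_sub_ge (x : R) : 0 <= x <= 1 ->
  (1 - w) * (x * (1 - x)) <= x `^ w - x.
Proof.
move=> /andP[x0 x1]; have [w1|w1] := eqVneq w 1.
  by rewrite w1 powRr1// !subrr mul0r.
have [->|xn0] := eqVneq x 0; first by rewrite powR0 ?gt_eqF// mul0r mulr0 subrr.
have w0' : 0 < 1 - w by rewrite subr_gt0 lt_neqAle w1.
have w1' : 1 - w <= 1 by rewrite gerBl ltW.
have := powR_le_tangent w0' w1' x0.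
have : x = x `^ w * x `^ (1 - w).
  by rewrite -powRD ?xn0 ?implybT// addrC subrK powRr1.
have : x `^ w <= 1.
  have : x `^ w <= 1 `^ w by apply: ge0_ler_powR; rewrite ?nnegrE// ltW.
  by rewrite powR1.
move: (powR_ge0 x w) (powR_ge0 x (1 - w)).
set s := x `^ w; set t := x `^ (1 - w) => s0 t0 s1 xE tle.
set u := (1 - w) * (1 - x).
have u0 : 0 <= u by rewrite /u mulr_ge0// ?subr_ge0// ltW.
have tu : t <= 1 - u by rewrite /u; lra.
have -> : (1 - w) * (x * (1 - x)) = x * u by rewrite /u; ring.
have : s * t * (1 + u) <= s * (1 - u) * (1 + u).
  by rewrite ler_wpM2r ?addr_ge0// ler_wpM2l.
rewrite -xE; have : 0 <= s * u ^+ 2 by rewrite mulr_ge0// sqr_ge0.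
by move=> ? ?; nra.
Qed.

(** Summing [powR_sub_ge] over the spectrum bounds the trace minus 1 below by c; since 0 <= c <= 1,
    also c <= c^w. The purity is polynomial in the state, so this bound passes easily to limits. *)
Lemma Gmx_ge m n (Y : 'M[C]_(m, n)) : sqnorm Y = 1 ->
  (1 - w) * (1 - sqnorm (Y *m Y^t*)) <= Gmx w Y.
Proof.
move=> Y1; have pur1 := sqnorm_gram_le1 Y1.
have pur0 := sqnorm_ge0 (Y *m Y^t*).
set c : R := _ * _.
have c0 : 0 <= c by rewrite /c mulr_ge0 ?subr_ge0.
have c1 : c <= 1 by rewrite /c mulr_ile1 ?subr_ge0// gerBl// ltW.
have cT : c <= trpow w (Y *m Y^t*) - 1.
  rewrite /c trpow_rowsq sqnorm_gram; set P := spectralmx _.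
  have PP : P^t* *m P = 1%:M := unitary_adjmul (spectral_unitarymx _).
  have l1 : \sum_k rowsq (P *m Y) k = 1 by rewrite -Y1 -(sqnorm_isom _ PP).
  rewrite -[X in (1 - w) * (X - _)]l1 -[X in _ <= _ - X]l1 -!sumrB.
  rewrite mulr_sumr; apply: ler_sum => k _.
  apply: le_trans (powR_sub_ge _); last first.
    by rewrite rowsq_ge0 -Y1 -(sqnorm_isom _ PP) rowsq_le_sqnorm.
  by rewrite le_eqVlt; apply/orP; left; apply/eqP; ring.
have [c00|cn0] := eqVneq c 0; first by rewrite c00; exact: powR_ge0.
apply: (@le_trans _ _ (c `^ w)).
  by apply: ger1_powR; rewrite // lt_neqAle eq_sym cn0 c0.
by apply: ge0_ler_powR; rewrite ?nnegrE ?(ltW w_gt0)// (le_trans c0).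
Qed.

(** The reduced state is the Gram matrix of the single column [a], so [trpow_le_colsq] bounds the
    trace of its power by 1. *)
Lemma Gconcurrence_pure_prodvec m n (a : 'cV[C]_m) (b : 'cV[C]_n) :
  unit_vector a -> unit_vector b -> Gconcurrence_pure w (prodvec a b) = 0.
Proof.
move=> a1 b1; have ab1 := unit_prodvec a1 b1.
rewrite Gconcurrence_pureE /Gmx.
have T1 : 1 <= trpow w (coefmx (prodvec a b) *m (coefmx (prodvec a b))^t*).
  by apply: trpow_ge1 => //; rewrite sqnorm_coefmx; exact/unit_vectorP.
suff T1' : trpow w (coefmx (prodvec a b) *m (coefmx (prodvec a b))^t*) <= 1.
  have -> : trpow w (coefmx (prodvec a b) *m (coefmx (prodvec a b))^t*) = 1.
    by apply/eqP; rewrite eq_le T1' T1.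
  by rewrite subrr powR0// gt_eqF.
rewrite coefmx_prodvec gram_outer//.
apply: le_trans (trpow_le_colsq w_gt0 w_le1 a) _.
rewrite big_ord_recl big_ord0 addr0.
have -> : colsq a 0 = 1; last by rewrite powR1.
by apply: complexI; rewrite -colsqE a1 mxE eqxx.
Qed.

Lemma separable_Gconcurrence0 m n (rho : 'M[C]_(m * n)) :
  separable rho -> Gconcurrence w rho <= 0.
Proof.
case=> K [p [a [b [[p0 p1] a1 b1 rE]]]].
have dec : pure_decomposition rho p (fun k => prodvec (a k) (b k)).
  split=> //; first by move=> k; exact: unit_prodvec.
  by rewrite rE; apply: eq_bigr => k _; rewrite projector_prodvec.
have := ens_pure_decomposition w dec.
rewrite big1 => [|k _]; last by rewrite Gconcurrence_pure_prodvec// mulr0.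
move=> /Gconcurrence_le_ens; apply.
by have [_ phi1 ->] := dec; rewrite trace_mixture// p1.
Qed.

End Exponent.
End Product.

(** * Caratheodory's theorem for cones *)

Section Caratheodory.
Variables (F : realFieldType) (T : Type) (X : finType) (g : T -> X -> F).

Definition conic_comb N (q : 'I_N -> F) (s : 'I_N -> T) x := \sum_i q i * g (s i) x.

(** More points than coordinates satisfy a nontrivial linear relation; subtracting a suitable
    multiple of it from the weights makes one of them vanish. *)
Lemma caratheodory_drop N (q : 'I_N.+1 -> F) (s : 'I_N.+1 -> T) :
  (#|X| <= N)%N -> (forall i, 0 <= q i) ->
  exists (k0 : 'I_N.+1) (q' : 'I_N -> F), (forall i, 0 <= q' i) /\
    conic_comb q' (s \o lift k0) =1 conic_comb q s.
Proof.
move=> XN q0; pose A := \matrix_(k < N.+1, i < #|X|) g (s k) (enum_val i).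
have : kermx A != 0.
  rewrite kermx_eq0 /row_free neq_ltn ltnS (leq_trans _ XN)//.
  exact: rank_leq_col.
case/rowV0Pn => v /sub_kermxP vA vn0.
have vg (u : 'rV[F]_N.+1) : u *m A = 0 -> forall x, \sum_k u 0 k * g (s k) x = 0.
  move=> uA x; transitivity ((u *m A) 0 (enum_rank x)); last by rewrite uA mxE.
  rewrite mxE; by apply: eq_bigr => k _; rewrite mxE enum_rankK.
(* Up to sign the relation has a positive coefficient, so the ratios minimised next range over a
   nonempty set. *)
have [u uA [k1 uk1]] : exists2 u : 'rV[F]_N.+1, u *m A = 0 & exists k, 0 < u 0 k.
  have [i vi] : exists i, v 0 i != 0.
    apply/existsP; apply: contraNT vn0 => /existsPn vz; apply/eqP/rowP => i.
    by rewrite mxE; apply/eqP; rewrite -[_ == _]negbK vz.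
  have [vp|vm|/eqP] := ltgtP (v 0 i) 0; last by rewrite (negbTE vi).
    by exists (- v); [rewrite mulNmx vA oppr0|exists i; rewrite mxE oppr_gt0].
  by exists v => //; exists i.
case: (@arg_minP _ _ _ k1 (fun k => 0 < u 0 k) (fun k => q k / u 0 k) uk1) => k0 uk0 kmin.
(* The least ratio is the largest multiple that keeps all weights nonnegative; it cancels the weight
   of index [k0]. *)
pose t := q k0 / u 0 k0; pose r k := q k - t * u 0 k.
have t0 : 0 <= t by rewrite divr_ge0// ltW.
have r0 k : 0 <= r k.
  rewrite subr_ge0; have [uk|uk] := ltP 0 (u 0 k).
    by rewrite -ler_pdivlMr//; exact: kmin.
  by apply: le_trans (q0 k); rewrite mulr_ge0_le0.
exists k0, (fun i => r (lift k0 i)); split=> // x; rewrite /conic_comb/=.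
have -> : \sum_i q i * g (s i) x = \sum_i r i * g (s i) x.
  rewrite [RHS](eq_bigr (fun k => q k * g (s k) x - t * (u 0 k * g (s k) x))).
    by rewrite sumrB -mulr_sumr vg// mulr0 subr0.
  by move=> k _; rewrite /r; ring.
by rewrite [RHS](@bigD1_ord _ _ _ _ k0)//= /r /t divfK ?gt_eqF// subrr mul0r add0r.
Qed.

(** The number of terms is made exactly [#|X|]: long combinations are shortened, short ones are
    padded by [t0] with weight 0. *)
Lemma caratheodory (P : T -> Prop) (t0 : T) N (q : 'I_N -> F) (s : 'I_N -> T) :
  P t0 -> (forall i, 0 <= q i) -> (forall i, P (s i)) ->
  exists (q' : 'I_#|X| -> F) (s' : 'I_#|X| -> T),
    [/\ forall i, 0 <= q' i, forall i, P (s' i)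
      & conic_comb q' s' =1 conic_comb q s].
Proof.
move=> Pt0; set D := #|X|.
(* With truncated subtraction this measure is the distance between N and D, which padding and
   dropping both decrease. *)
have [m] := ubnP (N - D + (D - N)); elim: m N q s => // m IH N q s.
rewrite ltnS => ltm q0 Ps; have [ND|DN|ND] := ltngtP N D.
- have [|||q' [s' [q'0 Ps' cE]]] := IH N.+1
    (fun i => if unlift ord0 i is Some j then q j else 0)
    (fun i => if unlift ord0 i is Some j then s j else t0).
  + by move: ltm ND; lia.
  + by move=> i; case: unliftP.
  + by move=> i; case: unliftP.
  exists q', s'; split=> // x; rewrite cE /conic_comb big_ord_recl unlift_none.
  by rewrite mul0r add0r; apply: eq_bigr => i _; rewrite liftK.
- case: N q s ltm q0 Ps DN => // N q s ltm q0 Ps DN.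
  have [k0 [q1 [q10 cE1]]] := caratheodory_drop s DN q0.
  have [|//||q' [s' [q'0 Ps' cE]]] := IH N q1 (s \o lift k0).
  + by move: ltm DN; lia.
  + by move=> i; exact: Ps.
  by exists q', s'; split=> // x; rewrite cE cE1.
by subst N; exists q, s.
Qed.

End Caratheodory.

(** * Limits along an ultrafilter *)

Section UltraLimit.
Import numFieldNormedType.Exports.
Local Open Scope classical_set_scope.
Variables (R : realType) (U : set_system nat).
Hypothesis (UU : UltraFilter U).
Local Notation C := R[i].

(** Compactness gives a cluster point, and a cluster point along an ultrafilter is a limit. One
    ultrafilter serves all bounded sequences at once, with no extraction of subsequences. *)
Lemma ultra_cvg (x : nat -> R) (a b : R) : (forall k, a <= x k <= b) ->
  exists l : R, x @ U --> l.
Proof.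
move=> xab; have [l [_ lx]] : `[a, b] `&` cluster (x @ U) !=set0.
  apply: (@segment_compact R a b (x @ U)).
  change (U (x @^-1` `[a, b])).
  by apply: filterE => k /=; rewrite in_itv/= xab.
exists l => V Vl; have [//|UV] := in_ultra_setVsetC (x @^-1` V) UU.
by have [y []] := lx (~` V) V UV Vl.
Qed.

Definition ccvg (z : nat -> C) (l : C) :=
  (fun k => complex.Re (z k)) @ U --> complex.Re l /\
  (fun k => complex.Im (z k)) @ U --> complex.Im l.

Lemma ccvg_cst z : ccvg (fun=> z) z.
Proof. by split; exact: cvg_cst. Qed.

Lemma ccvgD x y a b : ccvg x a -> ccvg y b -> ccvg (fun k => x k + y k) (a + b).
Proof.
have ReD (z t : C) : complex.Re (z + t) = complex.Re z + complex.Re t.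
  by case: z; case: t.
have ImD (z t : C) : complex.Im (z + t) = complex.Im z + complex.Im t.
  by case: z; case: t.
case=> xr xi [yr yi]; split.
  rewrite ReD; under eq_fun do rewrite ReD; exact: cvgD.
rewrite ImD; under eq_fun do rewrite ImD; exact: cvgD.
Qed.

Lemma ccvgM x y a b : ccvg x a -> ccvg y b -> ccvg (fun k => x k * y k) (a * b).
Proof.
have ReM (z t : C) : complex.Re (z * t) =
    complex.Re z * complex.Re t - complex.Im z * complex.Im t.
  by case: z; case: t.
have ImM (z t : C) : complex.Im (z * t) =
    complex.Re z * complex.Im t + complex.Im z * complex.Re t.
  by case: z => ? ?; case: t.
case=> xr xi [yr yi]; split.
  by rewrite ReM; under eq_fun do rewrite ReM; apply: cvgB; exact: cvgM.
by rewrite ImM; under eq_fun do rewrite ImM; apply: cvgD; exact: cvgM.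
Qed.

Lemma ccvg_conj x a : ccvg x a -> ccvg (fun k => Num.conj (x k)) (Num.conj a).
Proof.
have ReJ (z : C) : complex.Re (Num.conj z) = complex.Re z by case: z.
have ImJ (z : C) : complex.Im (Num.conj z) = - complex.Im z by case: z.
case=> xr xi; split.
  by rewrite ReJ; under eq_fun do rewrite ReJ.
by rewrite ImJ; under eq_fun do rewrite ImJ; exact: cvgN.
Qed.

Lemma ccvg_real (x : nat -> R) (a : R) :
  x @ U --> a -> ccvg (fun k => (x k)%:C) a%:C.
Proof. by move=> xa; split => //=; exact: cvg_cst. Qed.

Lemma ccvg_sum (I : Type) (r : seq I) (x : I -> nat -> C) a :
  (forall i, ccvg (x i) (a i)) ->
  ccvg (fun k => \sum_(i <- r) x i k) (\sum_(i <- r) a i).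
Proof.
move=> xa; elim: r => [|i r IH].
  by rewrite big_nil; under eq_fun do rewrite big_nil; exact: ccvg_cst.
by rewrite big_cons; under eq_fun do rewrite big_cons; exact: ccvgD.
Qed.

Lemma ccvg_unique x a b : ccvg x a -> ccvg x b -> a = b.
Proof.
case: a b => [a a'] [b b'] [/= xa xa'] [/= xb xb'].
by rewrite (cvg_unique _ xa xb) ?(cvg_unique _ xa' xb').
Qed.

Definition mxcvg m n (X : nat -> 'M[C]_(m, n)) (A : 'M[C]_(m, n)) :=
  forall i j, ccvg (fun k => X k i j) (A i j).

Lemma mxcvg_cst m n (A : 'M[C]_(m, n)) : mxcvg (fun=> A) A.
Proof. by move=> i j; exact: ccvg_cst. Qed.

Lemma mxcvgM m n p (X : nat -> 'M[C]_(m, n)) (Y : nat -> 'M[C]_(n, p)) A B :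
  mxcvg X A -> mxcvg Y B -> mxcvg (fun k => X k *m Y k) (A *m B).
Proof.
move=> XA YB i j; rewrite mxE; under eq_fun do rewrite mxE.
by apply: ccvg_sum => l; exact: ccvgM.
Qed.

Lemma mxcvg_adj m n (X : nat -> 'M[C]_(m, n)) A :
  mxcvg X A -> mxcvg (fun k => (X k)^t*) (A^t*).
Proof.
move=> XA i j; rewrite !mxE; under eq_fun do rewrite !mxE.
exact: ccvg_conj.
Qed.

Lemma mxcvg_unique m n (X : nat -> 'M[C]_(m, n)) A B :
  mxcvg X A -> mxcvg X B -> A = B.
Proof.
by move=> XA XB; apply/matrixP => i j; exact: ccvg_unique (XA i j) (XB i j).
Qed.

Lemma mxcvg_trace n (X : nat -> 'M[C]_n) A :
  mxcvg X A -> ccvg (fun k => \tr (X k)) (\tr A).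
Proof. by move=> XA; apply: ccvg_sum => i; exact: XA. Qed.

Lemma mxcvg_sqnorm m n (X : nat -> 'M[C]_(m, n)) A :
  mxcvg X A -> (fun k => sqnorm (X k)) @ U --> sqnorm A.
Proof.
move=> XA; have [] := mxcvg_trace (mxcvgM XA (mxcvg_adj XA)).
by rewrite sqnormE; under eq_fun do rewrite sqnormE.
Qed.

(** Compactness of the unit sphere: the entries are bounded, and the norm is continuous. *)
Lemma unit_vector_mxcvg d (v : nat -> 'cV[C]_d) :
  (forall k, unit_vector (v k)) -> exists l, mxcvg v l /\ unit_vector l.
Proof.
move=> v1; have bnd k i : -1 <= complex.Re (v k i 0) <= 1 /\
    -1 <= complex.Im (v k i 0) <= 1.
  have : sqmod (v k i 0) <= 1.
    have /unit_vectorP <- := v1 k; apply: le_trans (rowsq_le_sqnorm _ i).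
    by rewrite /rowsq big_ord_recl big_ord0 addr0.
  by rewrite /sqmod; split; apply/andP; split; nra.
have /fin_all_exists[l lE] : forall i, exists l, ccvg (fun k => v k i 0) l.
  move=> i.
  have [a ra] := ultra_cvg (fun k => (bnd k i).1).
  have [b ib] := ultra_cvg (fun k => (bnd k i).2).
  by exists (a +i* b).
exists (\col_i l i); have vl : mxcvg v (\col_i l i).
  by move=> i j; rewrite mxE (ord1 j).
split=> //; apply/unit_vectorP.
apply: (cvg_unique _ (mxcvg_sqnorm vl)) => //.
have -> : (fun k => sqnorm (v k)) = (fun=> 1).
  by apply/funext => k; exact/unit_vectorP.
exact: cvg_cst.
Qed.

End UltraLimit.

(** * Vanishing concurrence implies separability *)

Section Faithfulness.
Import numFieldNormedType.Exports.
Local Open Scope classical_set_scope.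
Variables (R : realType) (w : R).
Hypotheses (w_gt0 : 0 < w) (w_lt1 : w < 1).
Local Notation C := R[i].
Variables (m n : nat) (rho : 'M[C]_(m * n)).
Hypothesis rho_state : density rho.

Let w_le1 : w <= 1 := ltW w_lt1.

(* With the cost as an additional coordinate, Caratheodory's reduction
   preserves the average cost of a decomposition. *)
Let coord : finType := option (bool * ('I_(m * n) * 'I_(m * n)))%type.

Let coords (v : 'cV[C]_(m * n)) (x : coord) : R :=
  match x with
  | Some (b, (i, j)) => if b then complex.Re (projector v i j)
                        else complex.Im (projector v i j)
  | None => Gconcurrence_pure w v
  end.

Lemma Re_sumZ (I : finType) (q : I -> R) (z : I -> C) :
  complex.Re (\sum_i (q i)%:C * z i) = \sum_i q i * complex.Re (z i).
Proof.
apply: (big_ind2 (fun (a : C) b => complex.Re a = b)) => //.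
  by case=> ? ? b1 [? ?] b2 /= -> ->.
by move=> i _; case: (z i) => a b /=; rewrite mul0r subr0.
Qed.

Lemma Im_sumZ (I : finType) (q : I -> R) (z : I -> C) :
  complex.Im (\sum_i (q i)%:C * z i) = \sum_i q i * complex.Im (z i).
Proof.
apply: (big_ind2 (fun (a : C) b => complex.Im a = b)) => //.
  by case=> ? ? b1 [? ?] b2 /= -> ->.
by move=> i _; case: (z i) => a b /=; rewrite mul0r addr0.
Qed.

Lemma mixtureE d K (p : 'I_K -> R) (phi : 'I_K -> 'cV[C]_d) i j :
  (\sum_k (p k)%:C *: projector (phi k)) i j =
  \sum_k (p k)%:C * projector (phi k) i j.
Proof. by rewrite summxE; apply: eq_bigr => k _; rewrite mxE. Qed.

Lemma exists_unit_vector : exists v : 'cV[C]_(m * n), unit_vector v.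
Proof.
have [K [p [phi [[_ p1] phi1 _]]]] := density_pure_decomposition rho_state.
case: K p phi p1 phi1 => [p phi|K p phi _ phi1]; last by exists (phi ord0).
by rewrite big_ord0 => /eqP; rewrite eq_sym oner_eq0.
Qed.

Lemma unit_delta d (i : 'I_d) : unit_vector (delta_mx i 0 : 'cV[C]_d).
Proof.
apply/unit_vectorP; rewrite /sqnorm (bigD1 i)//= big1 ?addr0 => [|k ki].
  by rewrite /rowsq big_ord_recl big_ord0 mxE !eqxx /sqmod/= expr1n expr0n/= !addr0.
by rewrite /rowsq big_ord_recl big_ord0 mxE (negbTE ki) /sqmod/= expr0n/= !addr0.
Qed.

(** A filler for terms of weight 0, whose limit vector may fail to be a product. A state exists only
    if m and n are positive. *)
Lemma exists_unit_pair : exists (a : 'cV[C]_m) (b : 'cV[C]_n),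
  unit_vector a /\ unit_vector b.
Proof.
have [v /unit_vectorP] := exists_unit_vector.
case: (pickP 'I_(m * n)) => [k _ _|no].
  case: (mxtens_indexP k) => i j.
  by exists (delta_mx i 0), (delta_mx j 0); split; exact: unit_delta.
by rewrite /sqnorm big_pred0 => // /eqP; rewrite eq_sym oner_eq0.
Qed.

(** The number of terms does not depend on [c], so a sequence of decompositions has limits term by
    term. The trace restores the normalisation of the weights. *)
Lemma bounded_pure_decomposition c : ens w rho c ->
  exists (p : 'I_#|coord| -> R) phi,
    pure_decomposition rho p phi /\
    \sum_k p k * Gconcurrence_pure w (phi k) = c.
Proof.
have [_ _ rho1] := rho_state; have [v0 v01] := exists_unit_vector.
move=> /pure_decomposition_ens/(_ rho1)[K [p [phi [[[p0 p1] phi1 rE] ->]]]].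
have [q [psi [q0 psi1 cE]]] := caratheodory coords v01 p0 phi1.
have rE' : rho = \sum_k (q k)%:C *: projector (psi k).
  rewrite rE; apply/matrixP => i j; rewrite !mixtureE; apply/eqP.
  rewrite eq_complex !Re_sumZ !Im_sumZ; apply/andP; split; apply/eqP/esym.
    exact: (cE (Some (true, (i, j)))).
  exact: (cE (Some (false, (i, j)))).
exists q, psi; split; last exact: (cE None).
split=> //; split=> //.
by apply: complexI; rewrite -(trace_mixture q psi1) -rE' rho1.
Qed.

Lemma Gconcurrence0_separable : Gconcurrence w rho = 0 -> separable rho.
Proof.
move=> G0; have [_ _ rho1] := rho_state.
have /choice[D DE] : forall k : nat, exists D : ('I_#|coord| -> R) *
    ('I_#|coord| -> 'cV[C]_(m * n)), pure_decomposition rho D.1 D.2 /\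
    \sum_i D.1 i * Gconcurrence_pure w (D.2 i) < harmonic k.
  move=> k; have [||c rc ck] := @Gconcurrence_ens_lt R w m n rho (harmonic k) rho1.
  - exact: density_ens.
  - by rewrite G0 /harmonic invr_gt0.
  have [p [phi [dec cE]]] := bounded_pure_decomposition rc.
  by exists (p, phi); split=> //=; rewrite cE.
(* [U] refines [\oo], so the harmonic bound on the costs still tends to 0 along it. *)
have [U [UU ooU]] := @ultraFilterLemma nat \oo _.
have p01 k i : 0 <= (D k).1 i <= 1.
  have [[[p0 p1] _ _] _] := DE k; rewrite p0/= -p1 (bigD1 i)//= lerDl.
  exact: sumr_ge0.
have /fin_all_exists[p pE] : forall i, exists l : R,
    (fun k => (D k).1 i) @ U --> l by move=> i; apply: ultra_cvg (p01 ^~ i).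
have phi1 k i : unit_vector ((D k).2 i) by have [[]] := DE k.
have /fin_all_exists[phi phiE] : forall i, exists l : 'cV[C]_(m * n),
    mxcvg U (fun k => (D k).2 i) l /\ unit_vector l.
  by move=> i; exact: (unit_vector_mxcvg UU (phi1 ^~ i)).
have p0 i : 0 <= p i.
  apply: (@ler_cvg_to nat U _ R (fun=> 0) (fun k => (D k).1 i)) => //.
    exact: cvg_cst.
  by apply: filterE => k; case/andP: (p01 k i).
(* The entries of a mixture are polynomial in the weights, the vectors and their conjugates, so the
   constant sequence [rho] converges to the limit mixture. *)
have rE : rho = \sum_i (p i)%:C *: projector (phi i).
  apply: (mxcvg_unique UU (mxcvg_cst UU rho)) => a b; rewrite mixtureE.
  have -> : (fun=> rho a b) =
      (fun k => \sum_i ((D k).1 i)%:C * projector ((D k).2 i) a b).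
    by apply/funext => k; have [[_ _ {1}->] _] := DE k; rewrite mixtureE.
  apply: ccvg_sum => i; apply: ccvgM; first exact: ccvg_real.
  by have [vl _] := phiE i; apply: mxcvgM => //; exact: mxcvg_adj.
have p1 : \sum_i p i = 1.
  apply: complexI; rewrite -(trace_mixture p (fun i => (phiE i).2)) -rE.
  by rewrite rho1.
have Y1 (v : 'cV[C]_(m * n)) : unit_vector v -> sqnorm (coefmx v) = 1.
  by move=> /unit_vectorP; rewrite sqnorm_coefmx.
pose pur (v : 'cV[C]_(m * n)) := sqnorm (coefmx v *m (coefmx v)^t*).
(* Before the limit, [Gmx_ge] bounds this quantity by one term of the cost, hence by the whole cost,
   which tends to 0. *)
have ple i : p i * ((1 - w) * (1 - pur (phi i))) <= 0.
  apply: (@ler_cvg_to nat U _ R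
    (fun k => (D k).1 i * ((1 - w) * (1 - pur ((D k).2 i)))) harmonic) => //.
  - apply: cvgM => //; apply: cvgM; first exact: cvg_cst.
    apply: cvgB; first exact: cvg_cst.
    have Yc : mxcvg U (fun k => coefmx ((D k).2 i)) (coefmx (phi i)).
      move=> a b; rewrite mxE; under eq_fun do rewrite mxE.
      by have [vl _] := phiE i; exact: vl.
    by apply: mxcvg_sqnorm; apply: mxcvgM => //; exact: mxcvg_adj.
  - by move=> A /(@cvg_harmonic R) /ooU.
  apply: filterE => k; have [[[q0 _] _ _] /ltW cost] := DE k.
  apply: le_trans cost; rewrite (bigD1 i)//= -[leLHS]addr0 lerD//.
    rewrite ler_wpM2l// Gconcurrence_pureE; apply: Gmx_ge => //; exact: Y1.
  by apply: sumr_ge0 => j _; rewrite mulr_ge0// Gconcurrence_pure_ge0.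
have [a0 [b0 [a01 b01]]] := exists_unit_pair.
have /fin_all_exists[ab abE] : forall i, exists ab : 'cV[C]_m * 'cV[C]_n,
    [/\ unit_vector ab.1, unit_vector ab.2 & (p i)%:C *: projector (phi i) =
       (p i)%:C *: (projector ab.1 *t projector ab.2)].
  move=> i; have [pi0|pn0] := eqVneq (p i) 0.
    by exists (a0, b0); rewrite pi0 !scale0r.
  have p_gt0 : 0 < p i by rewrite lt_neqAle eq_sym pn0 p0.
  have [_ phii] := phiE i.
  have pur1 : pur (phi i) = 1.
    apply/eqP; rewrite eq_le sqnorm_gram_le1 ?Y1//=.
    have := ple i; rewrite pmulr_rle0// pmulr_rle0 ?subr_gt0//.
    by rewrite subr_le0.
  have [a [b [a1 b1 YE]]] := outer_of_purity1 (Y1 _ phii) pur1.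
  exists (a, b); split=> //=; congr (_ *: _); rewrite -projector_prodvec.
  by congr projector; apply: coefmx_inj; rewrite coefmx_prodvec.
exists #|coord|, p, (fun i => (ab i).1), (fun i => (ab i).2); split=> //.
- by move=> i; have [] := abE i.
- by move=> i; have [] := abE i.
- by rewrite rE; apply: eq_bigr => i _; have [] := abE i.
Qed.

End Faithfulness.

Theorem mainTheorem1 (R : realType) (w : R) (w_gt0 : 0 < w) (w_le1 : w <= 1)
    (m n : nat) (rho : 'M[R[i]]_(m * n)) (rho_state : density rho) :
  (* (i) for w = 1 the concurrence vanishes identically *)
  [/\ [/\ 0 <= Gconcurrence w rho,
          separable rho -> Gconcurrence w rho = 0
        & w < 1 -> Gconcurrence w rho = 0 -> separable rho],
  (* (ii) *)
      forall (I : finType) (dA dB : nat) (P : locc R I dA dB m n),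
        Gconcurrence w (locc_average P rho) <= Gconcurrence w rho,
  (* (iii) *)
      forall (UA : 'M[R[i]]_m) (UB : 'M[R[i]]_n),
        UA \is unitarymx -> UB \is unitarymx ->
        Gconcurrence w rho =
        Gconcurrence w ((UA *t UB) *m rho *m (UA^t* *t UB^t*)),
  (* (iv) *)
      forall (I : finType) (dA dB : nat) (P : locc R I dA dB m n)
             (p : I -> R) (sigma : I -> 'M[R[i]]_(dA * dB)),
        locc_ensemble P rho p sigma ->
        \sum_i p i * Gconcurrence w (sigma i) <= Gconcurrence w rho
  (* (v) *)
    & forall (K : nat) (p : 'I_K -> R) (rhos : 'I_K -> 'M[R[i]]_(m * n)),
        (forall k, 0 < p k) -> \sum_k p k = 1 ->
        (forall k, density (rhos k)) ->
        rho = \sum_k (p k)%:C *: rhos k ->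
        Gconcurrence w rho <= \sum_k p k * Gconcurrence w (rhos k)].
Proof.
have [_ _ rho1] := rho_state; have rho_ens := density_ens w rho_state.
have G_ge0 : 0 <= Gconcurrence w rho.
  by apply: Gconcurrence_ge_ens => // c /ens_ge0.
split; first split=> //.
- move=> rho_sep; apply/eqP; rewrite eq_le G_ge0 andbT.
  exact: separable_Gconcurrence0.
- by move=> w_lt1; exact: Gconcurrence0_separable.
- by move=> I dA dB P; exact: Gconcurrence_locc_average.
- by move=> UA UB UA1 UB1; exact: Gconcurrence_local_unitary.
- by move=> I dA dB P p sigma; exact: Gconcurrence_locc_ensemble.
- by move=> K p rhos p0 p1 rd ->; exact: Gconcurrence_convex.
Qed.
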